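(* Let $\mathcal X,\mathcal Y$ be real separable Hilbert spaces, $B,L\ge 0$, $\sigma>0$, $1\le p<\infty$, and let $\mu$ be a probability measure on $\mathcal X$ satisfying conditions (i), (ii), (iii-L), (iii-U) of the context. Suppose the noise is Hilbert-valued Gaussian noise and that the eigenvalues of the covariance operator of $\mu$ are $\lambda_i=i^{-\tau}$ for some $\tau>1$. Then $$\frac{\tau-1}{2}\log\left(\frac{\log(m/\sigma^2)}{\log(\log(m/\sigma^2))}\right)+\mathcal O_{\tau,\iota,\Upsilon,B,L,p}(1)\ \le\ \mathcal L_m(\mathcal F_{B,L};L^p_\mu)\ \lesssim_{\iota,p}\ \sqrt{\log(m/\sigma^2)}$$ as $m\to\infty$, where $\mathcal L_m(\mathcal F_{B,L};L^p_\mu)=-\log(\mathcal M_m(\mathcal F_{B,L};L^p_\mu))$, and $\mathcal M_m(\mathcal F_{B,L};L^p_\mu)$ is either the fixed-design or the random-design minimax risk.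
   Context: Conditions on $\mu$: (i) $\mu$ has mean zero and finite second moments, i.e. $\int_{\mathcal X}\|X\|_{\mathcal X}^2\,d\mu(X)<\infty$. (ii) Let $\lambda_1\ge\lambda_2\ge\cdots>0$ and $\{\phi_i\}_i\subset\mathcal X$ be the eigenvalues and orthonormal basis of eigenvectors of the covariance operator of $\mu$. The real-valued random variables $\xi_i=\langle X,\phi_i\rangle_{\mathcal X}/\sqrt{\lambda_i}$, $X\sim\mu$, are independent. (iii-L) Each $\xi_i$ is absolutely continuous with respect to Lebesgue measure, and there exist constants $a,b>0$ such that the densities $\nu_i$ of the $\xi_i$ satisfy $\nu_i(x)\ge b$ for all $|x|\le a$ and all $i=1,2,\dots$. Put $\iota=2ab\le1$. (iii-U) The $\xi_i$ have uniformly bounded $p'$th moments, where $p'=\max\{p,2\}$, i.e. $\sup_i(\mathbb E|\xi_i|^{p'})^{1/p'}<\infty$. Observations: $Y_i=F(X_i)+\sigma E_i$, $i=1,\dots,m$. Hilbert-valued Gaussian noise: $E_1,\dots,E_m$ are i.i.d. from a mean-zero Gaussian measure on $\mathcal Y$ with covariance operator $\Upsilon:\mathcal Y\to\mathcal Y$, $\mathrm{Tr}(\Upsilon)=1$. Class: $\mathcal F_{B,L}$ is the set of $F:\mathcal X\to\mathcal Y$ with $\|F(X)\|_{\mathcal Y}\le B$ and $\|F(X)-F(X')\|_{\mathcal Y}\le L\|X-X'\|_{\mathcal X}$ for all $X,X'\in\mathcal X$. Norm: $\|F\|_{L^p_\mu(\mathcal X;\mathcal Y)}=(\int_{\mathcal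 X}\|F(X)\|_{\mathcal Y}^p\,d\mu(X))^{1/p}$. Minimax risks: an estimator $\widehat F$ is a mapping from the data to $L^p_\mu(\mathcal X;\mathcal Y)$. Fixed design: $\mathcal M_m(\mathcal F;L^p_\mu)=\inf_{\mathcal D}\inf_{\widehat F}\sup_{F\in\mathcal F}\mathbb E\|F-\widehat F\|_{L^p_\mu(\mathcal X;\mathcal Y)}$, with infimum over designs $\mathcal D=\{X_1,\dots,X_m\}\subset\mathcal X$ and over estimators, and expectation over the $E_i$. Random design: $\mathcal M_m(\mathcal F;L^p_\mu)=\inf_\nu\inf_{\widehat F}\sup_{F\in\mathcal F}\mathbb E\|F-\widehat F\|_{L^p_\mu(\mathcal X;\mathcal Y)}$, with infimum over probability measures $\nu$ on $\mathcal X$ and over estimators, where $X_1,\dots,X_m$ are i.i.d. from $\nu$ and independent of the $E_i$, and expectation over the $X_i$ and $E_i$. Asymptotic notation: $A(m,r)\lesssim_r A'(m,r)$ as $m\to\infty$ means there is a constant $c(r)>0$ depending on the parameters $r$ only such that $A(m,r)\le c(r)A'(m,r)$ for all sufficiently large $m$. Likewise, $\mathcal O_r(1)$ denotes a term bounded in absolute value, for all sufficiently large $m$, by a constant depending on $r$ only.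
   Formalization: The upper bound on the log-risk is stated only for B>0 and L>0: for B=0 the risk is 0, and for L=0 constants are estimated at rate σ/√m, so the claimed upper bound fails in both cases. The lower bound is kept for all B,L≥0. *)

(* Defs.v *)
From HB Require Import structures.
From mathcomp Require Import all_boot all_order all_algebra.
From mathcomp Require Import all_classical all_reals all_analysis.

Set Implicit Arguments.
Unset Strict Implicit.
Unset Printing Implicit Defensive.

Import Order.TTheory GRing.Theory Num.Theory.
Import numFieldNormedType.Exports.

Local Open Scope classical_set_scope.
Local Open Scope ring_scope.

HB.mixin Record CompleteNormedModule_isHilbert (R : realType) V
    of CompleteNormedModule R V := {
  inner : {dot V for idfun} ;
  inner_norm : forall x : V, (inner : V -> V -> R) x x = `|x| ^+ 2
}.

#[short(type="hilbertType")]
HB.structure Definition Hilbert (R : realType) :=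
  {V of CompleteNormedModule R V & CompleteNormedModule_isHilbert R V}.

Definition separable_space (T : topologicalType) : Prop :=
  exists S : set T, countable S /\ dense S.

Definition borel (T : ptopologicalType) := g_sigma_algebraType (@open T).

Section hilbert.
Context {R : realType} {V : hilbertType R}.

Definition linear_span (S : set V) : set V :=
  [set v | exists (n : nat) (c : 'I_n -> R) (s : 'I_n -> V),
     (forall i, S (s i)) /\ v = \sum_(i < n) c i *: s i].

(* Families indexed by a subset [D] of [nat] cover both finite- and
   infinite-dimensional separable spaces. *)
Definition orthonormal_basis (D : set nat) (e : nat -> V) : Prop :=
  (forall i j, D i -> D j -> inner (e i) (e j) = (i == j)%:R) /\
  closure (linear_span (e @` D)) = setT.

(* For the (positive) covariance operators considered here, the value of the
   sum does not depend on the basis. *)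
Definition has_trace (T : V -> V) (t : R) : Prop :=
  exists (D : set nat) (e : nat -> V), orthonormal_basis D e /\
    (\esum_(i in D) (inner (T (e i)) (e i))%:E = t%:E)%E.

Definition mean_zero (P : probability (borel V) R) : Prop :=
  forall h : V, (\int[P]_x (inner x h)%:E = 0)%E.

Definition finite_second_moment (P : probability (borel V) R) : Prop :=
  (\int[P]_x ((`|x : V| ^+ 2)%:E) < +oo)%E.

(* No mean is subtracted: this is only used together with [mean_zero]. *)
Definition is_covariance (P : probability (borel V) R) (C : V -> V) : Prop :=
  forall h k : V,
    (\int[P]_x (inner x h * inner x k)%:E = (inner (C h) k)%:E)%E.

(* [normal_prob m s] is not a point mass when [s = 0]. *)
Definition gaussian_measure (P : probability (borel V) R) : Prop :=
  forall h : V, exists m s : R, forall A : set R, measurable A ->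
    P [set x : borel V | A (inner (x : V) h)] =
      if s == 0 then \d_m A else normal_prob m s A.

End hilbert.

Section random_variables.
Context {d} {T : measurableType d} {R : realType} (P : probability T R).

Definition mutually_independent (xi : nat -> T -> R) : Prop :=
  forall (J : seq nat) (A : nat -> set R), uniq J ->
    (forall i, i \in J -> measurable (A i)) ->
    (P (\bigcap_(i in [set` J]) (xi i @^-1` A i))
      = \prod_(i <- J) P (xi i @^-1` A i))%E.

Definition is_density (xi : T -> R) (f : R -> R) : Prop :=
  [/\ measurable_fun [set: R] f, forall x, 0 <= f x &
      forall A : set R, measurable A ->
        (P (xi @^-1` A) = \int[lebesgue_measure]_(x in A) (f x)%:E)%E].

End random_variables.

Section iid.
Context {d} {T : measurableType d} {R : realType}.

Definition tcons n (z : T * n.-tuple T) : n.+1.-tuple T :=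
  [the n.+1.-tuple T of z.1 :: z.2].

Lemma measurable_tcons n : measurable_fun [set: T * n.-tuple T] (@tcons n).
Proof. exact: measurable_cons. Qed.

HB.instance Definition _ n :=
  isMeasurableFun.Build _ _ _ _ (@tcons n) (@measurable_tcons n).

Fixpoint iid (P : probability T R) (n : nat) : probability (n.-tuple T) R :=
  match n with
  | 0 => \d_[tuple]
  | k.+1 => distribution (P \x iid P k)%E (@tcons k)
  end.

End iid.

Section measure_conditions.
Context {R : realType} {X : hilbertType R} (mu : probability (borel X) R).

Definition coordinate (lambda : nat -> R) (phi : nat -> X) (i : nat)
  (x : borel X) : R := inner (x : X) (phi i) / Num.sqrt (lambda i).

(* [lambda] and [phi] are indexed from 0. That 2ab <= 1 is a consequence. *)
Record measure_conditions (p : R) (lambda : nat -> R) (phi : nat -> X)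
    (a b : R) : Prop := {
  cond_mean : mean_zero mu ;
  cond_moment2 : finite_second_moment mu ;
  cond_lambda_gt0 : forall i, 0 < lambda i ;
  cond_lambda_nincr : forall i j, (i <= j)%N -> lambda j <= lambda i ;
  cond_basis : orthonormal_basis setT phi ;
  cond_eigen : exists C : {linear X -> X}, is_covariance mu C /\
    forall i, C (phi i) = lambda i *: phi i ;
  cond_indep : mutually_independent mu (coordinate lambda phi) ;
  cond_a_gt0 : 0 < a ;
  cond_b_gt0 : 0 < b ;
  cond_density : forall i, exists f : R -> R,
    is_density mu (coordinate lambda phi i) f /\
    forall x, `|x| <= a -> b <= f x ;
  cond_moments : (ereal_sup (range (fun i =>
    'N[mu]_((Num.max p 2)%:E) [EFin \o coordinate lambda phi i])) < +oo)%E
}.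

End measure_conditions.

Definition FBL {R : realType} {X Y : hilbertType R} (B L : R) : set (X -> Y) :=
  [set F | (forall x, `|F x| <= B) /\
           (forall x x', `|F x - F x'| <= L * `|x - x'|)].

Section Lp.
Context {R : realType} {X Y : hilbertType R}.
Variables (mu : probability (borel X) R) (p : R).

Definition Lp_norm (F : X -> Y) : \bar R :=
  'N[mu]_(p%:E) [(fun x : borel X => `|F x|%:E)].

(* Borel and strong measurability agree as [Y] is separable. Functions that
   agree almost everywhere are not identified. *)
Definition Lp : set (X -> Y) :=
  [set F | measurable_fun [set: borel X] (F : borel X -> borel Y) /\
           (Lp_norm F < +oo)%E].

Definition Lp_dist (F G : X -> Y) : \bar R := Lp_norm (fun x => F x - G x).

Definition Lp_open (U : set (X -> Y)) : Prop :=
  forall F, Lp F -> U F -> exists2 e : R, 0 < e &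
    forall G, Lp G -> (Lp_dist F G < e%:E)%E -> U G.

(* Measurability with respect to the Borel sigma-algebra of L^p_mu, which is
   what makes the risk of an estimator well-defined. *)
Definition estimator {d} (D : measurableType d) : set (D -> X -> Y) :=
  [set Fhat | (forall t, Lp (Fhat t)) /\
    forall U, Lp_open U -> measurable (Fhat @^-1` U)].

End Lp.
Arguments estimator {R X Y} mu p {d} D.

Inductive design_kind := FixedDesign | RandomDesign.

Section minimax.
Context {R : realType} {X Y : hilbertType R}.
Variables (mu : probability (borel X) R) (p : R).
Variables (gamma : probability (borel Y) R) (sigma : R).
Variables (cF : set (X -> Y)) (m : nat).

Local Notation data := (m.-tuple (borel X * borel Y)%type).

Definition observe (F : X -> Y) (x : m.-tuple (borel X))
    (e : m.-tuple (borel Y)) : data :=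
  [tuple (tnth x i, F (tnth x i) + sigma *: (tnth e i : Y)) | i < m].

Local Open Scope ereal_scope.

Definition fixed_design_risk : \bar R :=
  ereal_inf [set ereal_inf [set ereal_sup [set
      \int[iid gamma m]_e Lp_dist mu p F (Fhat (observe F x e))
    | F in cF] | Fhat in estimator mu p data] | x in [set: m.-tuple (borel X)]].

Definition random_design_risk : \bar R :=
  ereal_inf [set ereal_inf [set ereal_sup [set
      \int[iid nu m \x iid gamma m]_w
        Lp_dist mu p F (Fhat (observe F w.1 w.2))
    | F in cF] | Fhat in estimator mu p data]
    | nu in [set: probability (borel X) R]].

Definition minimax_risk (k : design_kind) : \bar R :=
  match k with
  | FixedDesign => fixed_design_risk
  | RandomDesign => random_design_risk
  end.

(* [lne 0 = -oo], so the log-risk is [+oo] when the risk vanishes. *)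
Definition log_minimax_risk (k : design_kind) : \bar R :=
  - lne (minimax_risk k).

End minimax.

Definition gaussian_noise {R : realType} {Y : hilbertType R}
    (gamma : probability (borel Y) R) (Upsilon : Y -> Y) : Prop :=
  [/\ gaussian_measure gamma, mean_zero gamma, is_covariance gamma Upsilon &
      has_trace Upsilon 1].

Record model {R : realType} (X Y : hilbertType R)
    (mu : probability (borel X) R) (gamma : probability (borel Y) R)
    (Upsilon : Y -> Y) (tau iota p B L sigma : R) : Prop := {
  model_sepX : separable_space X ;
  model_sepY : separable_space Y ;
  model_B : 0 <= B ;
  model_L : 0 <= L ;
  model_sigma : 0 < sigma ;
  model_p : 1 <= p ;
  model_tau : 1 < tau ;
  model_mu : exists (phi : nat -> X) (a b : R), iota = 2 * a * b /\
    measure_conditions mu p (fun i => i.+1%:R `^ (- tau)) phi a b ;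
  model_noise : gaussian_noise gamma Upsilon
}.

(* Main.v *)
Require Import Defs.
From HB Require Import structures.
From mathcomp Require Import all_boot all_order all_algebra.
From mathcomp Require Import all_classical all_reals all_analysis.
From mathcomp Require Import measurable_realfun.
From mathcomp Require Import ring lra zify.

(** The two inequalities bound the minimax risk from above and from below, and
only the dimension in which one effectively works matters.

Upper bound on the risk. A function of the class is well approximated by one that
depends on the first [d] coordinates only: the error is at most the Lipschitz
constant times the [L^p] norm of the distance to the leading eigenspace, and since
the eigenvalues are summable with tail [d `^ (1 - tau)], this norm is of order
[d `^ (- ((tau - 1) / 2))]. For [p > 2] this needs a moment inequality for sums of
independent variables ([rosenthal_nonneg]), which also shows that for large [d] the
constant does not depend on the moment bounds ([tail_moment]). On a box of
polynomial size in the first [d] coordinates, take a grid of polynomially small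
mesh, sample at the centres of its cells, either drawn uniformly or in a fixed
balanced way, and estimate the value at a centre by the sum of the observations
there divided by their expected number. The errors are controlled by second
moments alone ([averaging_risk]), and they are negligible as soon as [m] is a power
of the number of cells, that is for [d * ln d] a small multiple of [ln m]
([risk_upper_rate]). This allows for [d] of order [ln m / ln (ln m)].

Lower bound on the risk. Split the cube on which the densities of the first [d]
coordinates are bounded below into [n ^ d >= 2 * m] cells and consider sums of
bumps over sets of cells. Whatever the design, at least half of the cells contain
no design point. Flipping the bumps of these cells leaves the data unchanged, for
every realisation of the noise, but moves the function by an amount of order
[d `^ (- (tau / 2)) / n * (a * b) ^+ d] in [L^p] norm. Averaging over all sets of
cells, no estimator can do better than this ([minimax_risk_ge]). With [d] of order
[sqrt (ln m)] and [n] of order [expR d] the logarithm of this bound is of order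
[- sqrt (ln m)], with a constant that depends on [a * b] only ([near_mesh]).

In both bounds the noise level is a fixed number, and so is invisible in
[ln (m / sigma ^+ 2)] up to a factor close to one. *)

Set Implicit Arguments.
Unset Strict Implicit.
Unset Printing Implicit Defensive.

Import Order.TTheory GRing.Theory Num.Theory.
Import numFieldNormedType.Exports.

Local Open Scope classical_set_scope.
Local Open Scope ring_scope.

(** * Inner products and Parseval's inequality *)

Section inner_product.
Context {R : realType} {V : hilbertType R}.
Implicit Types x y z : V.

Lemma innerC x y : inner x y = inner y x.
Proof. by rewrite hermC expr0 mul1r. Qed.

Lemma innerDl x y z : inner (x + y) z = inner x z + inner y z.
Proof. exact: linearDl. Qed.

Lemma innerDr x y z : inner z (x + y) = inner z x + inner z y.
Proof. exact: linearDr. Qed.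

Lemma innerZl a x y : inner (a *: x) y = a * inner x y.
Proof. exact: linearZl_LR. Qed.

Lemma innerZr a x y : inner x (a *: y) = a * inner x y.
Proof. by rewrite innerC innerZl innerC. Qed.

Lemma innerBl x y z : inner (x - y) z = inner x z - inner y z.
Proof. exact: linearBl. Qed.

Lemma inner_suml I (r : seq I) (P : pred I) (f : I -> V) y :
  inner (\sum_(i <- r | P i) f i) y = \sum_(i <- r | P i) inner (f i) y.
Proof. exact: linear_sumlz. Qed.

Lemma inner_sumr I (r : seq I) (P : pred I) (f : I -> V) y :
  inner y (\sum_(i <- r | P i) f i) = \sum_(i <- r | P i) inner y (f i).
Proof. by rewrite innerC inner_suml; apply: eq_bigr => i _; rewrite innerC. Qed.

Lemma sqr_normD x y :
  `|x + y| ^+ 2 = `|x| ^+ 2 + 2 * inner x y + `|y| ^+ 2.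
Proof.
by rewrite -!inner_norm !innerDl !innerDr (innerC y x) mulr2n mulrDl mul1r !addrA.
Qed.

Lemma sqr_normB x y :
  `|x - y| ^+ 2 = `|x| ^+ 2 - 2 * inner x y + `|y| ^+ 2.
Proof.
by rewrite sqr_normD normrN -[- y]scaleN1r innerZr mulN1r mulrN.
Qed.

Lemma inner_le_norm x y : `|inner x y| <= `|x| * `|y|.
Proof.
have [->|y0] := eqVneq y 0; first by rewrite linear0r !normr0 mulr0.
have y_gt0 : 0 < `|y| by rewrite normr_gt0.
rewrite -(@ler_pXn2r _ 2) ?nnegrE ?mulr_ge0// exprMn real_normK ?num_real//.
have := sqr_ge0 `|(`|y| ^+ 2) *: x - inner x y *: y|.
rewrite sqr_normB innerZl innerZr !normrZ !exprMn !(real_normK (num_real _)) => h.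
have {h} : 0 <= `|y| ^+ 2 * ((`|x| ^+ 2 * `|y| ^+ 2) - inner x y ^+ 2).
  by apply: le_trans h _; rewrite le_eqVlt; apply/orP; left; apply/eqP; ring.
by rewrite pmulr_rge0 ?exprn_gt0// subr_ge0.
Qed.

Lemma orthonormal_norm1 (D : set nat) (e : nat -> V) i :
  orthonormal_basis D e -> D i -> `|e i| = 1.
Proof.
move=> [orth _] Di; apply/eqP.
by rewrite -(@pexpr_eq1 _ _ 2)// -inner_norm orth// eqxx.
Qed.

(** Expanding [`|y - v| ^+ 2] for [v] in the span of the basis leaves
    [`|y| ^+ 2] minus at most the squares of the coordinates of [y]. *)
Lemma parseval_le (D : set nat) (e : nat -> V) (y : V) :
  orthonormal_basis D e ->
  ((`|y| ^+ 2)%:E <= \sum_(0 <= i <oo | i \in D) (inner y (e i) ^+ 2)%:E)%E.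
Proof.
move=> [orth dense].
apply/lee_addgt0Pr => eps eps0.
pose r := Num.min 1 eps.
have r0 : 0 < r by rewrite lt_min ltr01.
have : closure (linear_span (e @` D)) y by rewrite dense.
move=> /(_ _ (nbhsx_ballx y r r0)) [_ [[n [c [s [Ds ->]]]]]].
rewrite -ball_normE /= => yv.
have /choice[k kP] : forall i, exists j, D j /\ e j = s i.
  by move=> i; have [j] := Ds i; exists j.
pose N := (\max_i k i).+1.
pose b j := \sum_(i < n | k i == j) c i.
have bD j : ~ D j -> b j = 0.
  move=> Dj; rewrite /b big_pred0// => i; apply/eqP => kij.
  by apply: Dj; rewrite -kij; case: (kP i).
have vE : \sum_(i < n) c i *: s i = \sum_(j < N) b j *: e j.
  rewrite (eq_bigr (fun i => \sum_(j < N | k i == j) c i *: e j)); last first.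
    move=> i _; have kN : (k i < N)%N by rewrite ltnS (leq_bigmax i).
    rewrite (big_pred1 (Ordinal kN)); last first.
      by move=> j /=; rewrite -val_eqE eq_sym.
    by case: (kP i) => _ ->.
  rewrite (exchange_big_dep predT)//=; apply: eq_bigr => j _.
  by rewrite -scaler_suml.
have vv : `|\sum_(j < N) b j *: e j| ^+ 2 = \sum_(j < N) b j ^+ 2.
  rewrite -inner_norm inner_suml; apply: eq_bigr => j _.
  rewrite innerZl inner_sumr.
  have [Dj|Dj] := pselect (D j); last by rewrite bD// mul0r expr0n.
  rewrite (bigD1 j)//= innerZr orth// eqxx mulr1 big1 ?addr0 ?expr2//.
  move=> i ij; have [Di|Di] := pselect (D i); last by rewrite bD// scale0r linear0r.
  by rewrite innerZr orth// eq_sym (negbTE (ij : (i != j :> nat))) mulr0.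
have key : `|y| ^+ 2 <= \sum_(j < N | (j : nat) \in D) inner y (e j) ^+ 2 + eps.
  have : `|y - \sum_(i < n) c i *: s i| ^+ 2 <= eps.
    apply: (@le_trans _ _ (r * 1)).
      by rewrite expr2 ler_pM// ?ltW// (lt_le_trans yv)// ge_min lexx.
    by rewrite mulr1 ge_min lexx orbT.
  rewrite vE sqr_normB vv inner_sumr.
  have : \sum_(j < N) (2 * inner y (b j *: e j) - b j ^+ 2) <=
      \sum_(j < N | (j : nat) \in D) inner y (e j) ^+ 2.
    rewrite [leRHS]big_mkcond; apply: ler_sum => j _; case: ifPn => [_|].
      rewrite innerZr -subr_ge0.
      have -> : inner y (e j) ^+ 2 - (2 * (b j * inner y (e j)) - b j ^+ 2)
              = (b j - inner y (e j)) ^+ 2 by ring.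
      exact: sqr_ge0.
    by rewrite notin_setE => /bD ->; rewrite scale0r linear0r mulr0 expr0n subr0.
  rewrite sumrB -mulr_sumr => h1 h2; lra.
apply: (@le_trans _ _ ((\sum_(j < N | (j : nat) \in D) inner y (e j) ^+ 2)%:E + eps%:E)%E).
  by rewrite -EFinD lee_fin.
rewrite leeD2r// -(big_mkord (fun j => j \in D) (fun j => inner y (e j) ^+ 2)).
by rewrite -sumEFin; apply: nneseries_lim_ge => i _; rewrite lee_fin sqr_ge0.
Qed.

End inner_product.

(** * Borel measurability of maps into a separable Hilbert space *)

Section borel_measurability.
Context {R : realType}.

Lemma open_borel (T : ptopologicalType) (A : set T) :
  open A -> measurable (A : set (borel T)).
Proof. by move=> oA; apply: sub_sigma_algebra. Qed.

Lemma continuous_borel (T : ptopologicalType) (f : T -> R) :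
  continuous f -> measurable_fun [set: borel T] (f : borel T -> R).
Proof.
move=> /continuousP cf; apply: (measurability _ (measurable_realfun.RGenOpens.measurableE R)) => //.
move=> _ [_ [a [b ->]] <-]; rewrite setTI.
by apply: open_borel; apply: cf; exact: interval_open.
Qed.

Lemma continuous_borel_borel (T U : ptopologicalType) (f : T -> U) :
  continuous f -> measurable_fun [set: borel T] (f : borel T -> borel U).
Proof.
move=> /continuousP cf; apply: (@measurability _ _ _ (borel U) _ _ (@open U)) => //.
move=> _ [A oA <-]; rewrite setTI; apply: open_borel; exact: cf.
Qed.

Lemma lipschitz_continuous (V W : normedModType R) (f : V -> W) (L : R) :
  (forall x y, `|f x - f y| <= L * `|x - y|) -> continuous f.
Proof.
move=> fL x; apply/cvgrPdist_lt => eps eps0; near=> y.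
apply: (le_lt_trans (fL x y)).
have L0 : 0 < `|L| + 1 by rewrite ltr_wpDl.
apply: (@le_lt_trans _ _ ((`|L| + 1) * `|x - y|)).
  by rewrite ler_wpM2r// (le_trans (ler_norm _))// lerDl.
rewrite -ltr_pdivlMl// mulrC.
near: y; apply: cvgr_dist_lt => //; rewrite ?divr_gt0//; exact: cvg_id.
Unshelve. all: by end_near. Qed.

Context {V : hilbertType R}.

Lemma continuous_inner (h : V) : continuous (fun x : V => inner x h).
Proof.
apply: (@lipschitz_continuous _ _ _ `|h|) => x y.
by rewrite -innerBl mulrC inner_le_norm.
Qed.

Lemma continuous_dist (c : V) : continuous (fun x : V => `|x - c|).
Proof.
apply: (@lipschitz_continuous _ _ _ 1) => x y.
by rewrite mul1r (le_trans (ler_dist_dist _ _))// opprB addrA subrK.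
Qed.

Lemma measurable_inner (h : V) :
  measurable_fun [set: borel V] (fun x : borel V => inner (x : V) h).
Proof. by apply: continuous_borel; exact: continuous_inner. Qed.

Lemma measurable_hnorm : measurable_fun [set: borel V] (fun x : borel V => `|x : V|).
Proof.
have := continuous_borel (@continuous_dist 0).
by under [X in measurable_fun _ X -> _]eq_fun do rewrite subr0.
Qed.

Lemma measurable_set1_borel (z : V) : measurable ([set z] : set (borel V)).
Proof.
rewrite -[X in measurable X]setCK; apply: measurableC; apply: open_borel.
by rewrite openC; apply: accessible_closed_set1; exact: hausdorff_accessible.
Qed.

Lemma measurable_hscalel (u : V) :
  measurable_fun [set: R] ((fun r : R => r *: u) : R -> borel V).
Proof.
apply: (@measurability _ _ _ (borel V) _ _ (@open V)) => //.
move=> _ [U oU <-]; rewrite setTI; apply: open_measurable.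
have /continuousP := @scalel_continuous R V u; exact.
Qed.

Lemma measurable_norm_ge (r : R) : measurable [set x : borel V | r <= `|x : V|].
Proof.
have := @measurable_hnorm measurableT (`[r, +oo[)%classic (measurable_itv _).
by rewrite setTI (_ : _ @^-1` _ = [set x : borel V | r <= `|x : V|])//;
  apply/seteqP; split => x /=; rewrite in_itv /= andbT.
Qed.

Hypothesis sepV : separable_space V.

Lemma dense_sequence : exists s : nat -> V,
  forall (v : V) (r : R), 0 < r -> exists k, `|v - s k| < r.
Proof.
have [S [cS dS]] := sepV.
have [s0 Ss0] : S !=set0.
  have [|x [_ Sx]] := dS setT _ openT; last by exists x.
  by exists 0.
have [s Ss] : exists s : nat -> V, S `<=` range s.
  have /countable_injP[f injf] := cS.
  exists (fun n => xget s0 [set x | S x /\ f x = n]) => x Sx; exists (f x) => //.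
  case: xgetP => [y _ [Sy fy]|/(_ x)]; last by case.
  by apply: injf => //; rewrite inE.
exists s => v r r0.
have [|x [vx Sx]] := dS (ball v r) _ (ball_open _ _).
  by exists v; exact: ballxx.
have [k _ sk] := Ss _ Sx; exists k; rewrite sk.
by move: vx; rewrite -ball_normE.
Qed.

(** A set of [I]-indexed families is open for the sup distance iff it is a union
    of boxes; by separability countably many boxes suffice, which is what makes
    jointly continuous functions of finitely many measurable maps measurable. *)
Lemma measurable_open_family {d} {T : measurableType d} (I : finType)
    (f : I -> T -> V) (W : set (I -> V)) :
  (forall i, measurable_fun [set: T] (f i : T -> borel V)) ->
  (forall v, W v -> exists2 r : R, 0 < r &
     forall v', (forall i, `|v' i - v i| < r) -> W v') ->
  measurable [set t | W (fun i => f i t)].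
Proof.
move=> mf oW; have [s sP] := dense_sequence.
pose box (kn : {ffun I -> nat} * nat) : set (I -> V) :=
  [set v | forall i, `|v i - s (kn.1 i)| < kn.2.+1%:R^-1].
have -> : [set t | W (fun i => f i t)] =
    \bigcup_(kn in [set kn | box kn `<=` W]) [set t | box kn (fun i => f i t)].
  apply/seteqP; split => [t /= Wt|t [kn /= boxW /boxW//]].
  have [r r0 rW] := oW _ Wt.
  have [n nr] : exists n : nat, n.+1%:R^-1 < r / 2.
    have [n] := @near_infty_natSinv_lt R (PosNum (divr_gt0 r0 (ltr0Sn R 1))).
    by move=> _ /(_ n (leqnn n)) /=; exists n.
  have /choice[k kP] : forall i, exists k, `|f i t - s k| < n.+1%:R^-1.
    by move=> i; apply: sP.
  exists ([ffun i => k i], n) => /=; last by move=> i /=; rewrite ffunE.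
  move=> v /= bv; apply: rW => i.
  have := bv i; have := kP i; rewrite /= ffunE => h1 h2.
  have -> : v i - f i t = (v i - s (k i)) - (f i t - s (k i)).
    by rewrite opprB addrA subrK.
  by rewrite (le_lt_trans (ler_normB _ _))// (splitr r) ltrD// (lt_trans _ nr).
rewrite bigcup_mkcond; apply: countable_bigcupT_measurable => [|kn]; first exact: countableP.
case: ifPn => // _.
have -> : [set t | box kn (fun i => f i t)] =
    \bigcap_(i in [set: I]) (f i @^-1` (ball (s (kn.1 i)) (kn.2.+1%:R^-1) : set V)).
  apply/seteqP; split => t /= bt i.
    by move=> _; have := bt i; rewrite /= -ball_normE /= distrC.
  by have := bt i Logic.I; rewrite /= -ball_normE /= distrC.
apply: fin_bigcap_measurable; first exact: finite_finset.
move=> i _; rewrite -[X in measurable X]setTI; apply: mf => //.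
by apply: open_borel; exact: ball_open.
Qed.

Lemma measurable_borelP {d} {T : measurableType d} (f : T -> V) :
  (forall U : set V, open U -> measurable (f @^-1` U)) ->
  measurable_fun [set: T] (f : T -> borel V).
Proof.
move=> mf; apply: (@measurability _ _ _ (borel V) _ _ (@open V)) => //.
by move=> _ [A oA <-]; rewrite setTI; exact: mf.
Qed.

Lemma measurable_hsum {d} {T : measurableType d} (I : finType) (f : I -> T -> V) :
  (forall i, measurable_fun [set: T] (f i : T -> borel V)) ->
  measurable_fun [set: T] ((fun t => \sum_i f i t) : T -> borel V).
Proof.
move=> mf; apply: measurable_borelP => U oU.
apply: (measurable_open_family (W := fun v => U (\sum_i v i))) => // v Uv.
have /nbhs_ballP[r /= r0 rU] := open_nbhs_nbhs (conj oU Uv).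
have I0 : 0 < #|I|.+1%:R :> R by [].
exists (r / #|I|.+1%:R); first by rewrite divr_gt0.
move=> v' v'v; apply: rU; rewrite -ball_normE /= distrC -sumrB.
apply: (le_lt_trans (ler_norm_sum _ _ _)).
apply: (@le_lt_trans _ _ (\sum_(i : I) r / #|I|.+1%:R)).
  by apply: ler_sum => i _; apply/ltW/v'v.
rewrite sumr_const -[_ *+ _]mulr_natr -mulrA gtr_pMr//.
by rewrite mulrC ltr_pdivrMr// mul1r ltr_nat.
Qed.

Lemma measurable_hadd {d} {T : measurableType d} (f g : T -> V) :
  measurable_fun [set: T] (f : T -> borel V) ->
  measurable_fun [set: T] (g : T -> borel V) ->
  measurable_fun [set: T] ((fun t => f t + g t) : T -> borel V).
Proof.
move=> mf mg.
have := @measurable_hsum _ T bool (fun b => if b then f else g).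
by under eq_fun do rewrite big_bool /=; apply; case.
Qed.

Lemma measurable_hscale {d} {T : measurableType d} (a : R) (f : T -> V) :
  measurable_fun [set: T] (f : T -> borel V) ->
  measurable_fun [set: T] ((fun t => a *: f t) : T -> borel V).
Proof.
move=> mf; apply: (@measurableT_comp _ _ _ _ _ _ (( *:%R a) : borel V -> borel V)) => //.
by apply: continuous_borel_borel; exact: scaler_continuous.
Qed.

End borel_measurability.

(** * Second moments under i.i.d. samples *)

Lemma integral_probability_cst {d} {T : measurableType d} {R : realType}
    (P : probability T R) (c : R) : (\int[P]__ c%:E = c%:E)%E.
Proof. by rewrite integral_cst// [X in (_ * X)%E](probability_setT P) mule1. Qed.

Section iid_moments.
Context {d} {T : measurableType d} {R : realType} (P : probability T R).

Lemma integral_iidS n (f : n.+1.-tuple T -> \bar R) :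
  measurable_fun [set: n.+1.-tuple T] f -> (forall z, 0 <= f z)%E ->
  (\int[iid P n.+1]_z f z = \int[P]_x \int[iid P n]_y f (tcons (x, y)))%E.
Proof.
move=> mf f0; rewrite /= ge0_integral_distribution// fubini_tonelli1//.
- by apply: measurableT_comp => //; exact: measurable_tcons.
- by move=> x; exact: f0.
Qed.

Context {V : hilbertType R}.
Hypothesis sepV : separable_space V.

Section moment.
Variables (f : T -> V) (s : R).
Hypothesis mf : measurable_fun [set: T] (f : T -> borel V).
Hypothesis f0 : forall h : V, (\int[P]_x (inner (f x) h)%:E = 0)%E.
Hypothesis fs : (\int[P]_x (`|f x| ^+ 2)%:E <= s%:E)%E.

Lemma measurable_norm2 {d'} {T' : measurableType d'} (g : T' -> V) :
  measurable_fun [set: T'] (g : T' -> borel V) ->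
  measurable_fun [set: T'] (fun x => (`|g x| ^+ 2)%:E).
Proof.
move=> mg; apply/measurable_EFinP; apply: measurable_funX.
exact: (measurableT_comp measurable_hnorm mg).
Qed.

Let int_norm2 : P.-integrable setT (fun x => (`|f x| ^+ 2)%:E).
Proof.
apply/integrableP; split; first exact: measurable_norm2.
under eq_integral do rewrite gee0_abs ?lee_fin ?sqr_ge0//.
exact: le_lt_trans fs (ltry _).
Qed.

Let int_inner h : P.-integrable setT (fun x => (inner (f x) h)%:E).
Proof.
have ic : P.-integrable setT (EFin \o cst (`|h| ^+ 2 + 1 : R)).
  exact: finite_measure_integrable_cst.
apply: (le_integrable measurableT _ _ (integrableD measurableT int_norm2 ic)).
  apply/measurable_EFinP.
  exact: (measurableT_comp (measurable_inner h) mf).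
move=> x _ /=; rewrite lee_fin.
apply: (le_trans (inner_le_norm _ _)); rewrite ger0_norm; last first.
  by rewrite addr_ge0 ?sqr_ge0// addr_ge0 ?sqr_ge0.
have := sqr_ge0 (`|f x| - `|h|); rewrite sqrrB.
have := mulr_ge0 (normr_ge0 (f x)) (normr_ge0 h); lra.
Qed.

Lemma integral_affine_norm2 (v : V) (a c : R) :
  0 <= c ->
  (\int[P]_x (`|v + a *: f x| ^+ 2 + c)%:E <= (`|v| ^+ 2 + a ^+ 2 * s + c)%:E)%E.
Proof.
move=> c0.
have -> : (fun x => (`|v + a *: f x| ^+ 2 + c)%:E) =
    (fun x => (`|v| ^+ 2 + c)%:E + ((2 * a)%:E * (inner (f x) v)%:E +
       (a ^+ 2)%:E * (`|f x| ^+ 2)%:E))%E.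
  apply/funext => x; rewrite -!EFinM -!EFinD; congr EFin.
  rewrite sqr_normD innerZr innerC normrZ exprMn real_normK ?num_real//; ring.
have i1 : P.-integrable setT (fun x => (2 * a)%:E * (inner (f x) v)%:E)%E.
  exact: integrableZl.
have i2 : P.-integrable setT (fun x => (a ^+ 2)%:E * (`|f x| ^+ 2)%:E)%E.
  exact: integrableZl.
rewrite integralD//; last 2 first.
- exact: (finite_measure_integrable_cst P (`|v| ^+ 2 + c)).
- exact: integrableD.
rewrite integralD//.
rewrite integral_probability_cst.
rewrite !integralZl// f0 mule0 add0e.
have -> : (`|v| ^+ 2 + a ^+ 2 * s + c)%:E = ((`|v| ^+ 2 + c)%:E + (a ^+ 2 * s)%:E)%E.
  by rewrite -EFinD addrAC.
apply: leeD => //.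
by apply: (lee_wpmul2l _ fs); rewrite lee_fin sqr_ge0.
Qed.

(** The cross terms vanish since the summands are independent and centered;
    integrating out one coordinate at a time they never have to be formed. *)
Lemma iid_second_moment n (a : 'I_n -> R) (v : V) :
  (\int[iid P n]_z (`|v + \sum_(i < n) a i *: f (tnth z i)| ^+ 2)%:E <=
   (`|v| ^+ 2 + (\sum_(i < n) a i ^+ 2) * s)%:E)%E.
Proof.
have s0 : 0 <= s.
  by rewrite -lee_fin (le_trans _ fs)// integral_ge0// => x _; rewrite lee_fin sqr_ge0.
have msum m (b : 'I_m -> R) (w : V) : measurable_fun [set: m.-tuple T]
    (fun z => (`|w + \sum_(i < m) b i *: f (tnth z i)| ^+ 2)%:E).
  apply: measurable_norm2; apply: measurable_hadd => //.
  apply: measurable_hsum => // i; apply: measurable_hscale.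
  exact: (measurableT_comp mf (measurable_tnth i)).
elim: n a v => [|n IH] a v.
  under eq_integral do rewrite big_ord0 addr0.
  by rewrite integral_probability_cst big_ord0 mul0r addr0.
rewrite integral_iidS//.
pose c := (\sum_(i < n) a (lift ord0 i) ^+ 2) * s.
have c0 : 0 <= c by rewrite mulr_ge0// sumr_ge0// => i _; rewrite sqr_ge0.
apply: (@le_trans _ _ (\int[P]_x (`|v + a ord0 *: f x| ^+ 2 + c)%:E)%E).
  apply: ge0_le_integral => //.
  - by move=> x _; apply: integral_ge0 => y _; rewrite lee_fin sqr_ge0.
  - have m1 := @measurableT_comp _ _ _ _ _ _ _ _ _ (msum n.+1 a v) (@measurable_tcons _ T n).
    apply: (measurable_fun_fubini_tonelli_F (m2 := iid P n) _ m1) => z.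
    by rewrite lee_fin sqr_ge0.
  - apply/measurable_EFinP; apply: measurable_funD => //.
    apply/measurable_EFinP; apply: measurable_norm2.
    by apply: measurable_hadd => //; exact: measurable_hscale.
  - move=> x _.
    under eq_integral => y _.
      rewrite big_ord_recl addrA (_ : tnth _ ord0 = x)//.
      under eq_bigr => i _ do rewrite tnthS.
      over.
    exact: IH.
apply: (le_trans (integral_affine_norm2 _ _ c0)).
by rewrite lee_fin big_ord_recl mulrDl addrA.
Qed.

End moment.
End iid_moments.

(** * Moments of sums of independent nonnegative variables *)

Section powR_inequalities.
Context {R : realType}.
Implicit Types s z q t : R.

Lemma powR_add_le q s z : 1 <= q -> 0 <= s -> 0 <= z ->
  (s + z) `^ q <= s `^ q + 2 `^ q * (z * s `^ (q - 1)) + 2 `^ q * z `^ q.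
Proof.
move=> q1 s0 z0; have q0 : 0 <= q by rewrite (le_trans _ q1).
have [sz|/ltW zs] := leP s z.
  rewrite ler_wpDl//; first by rewrite addr_ge0 ?mulr_ge0 ?powR_ge0.
  rewrite -powRM//; apply: ge0_ler_powR; rewrite ?nnegrE ?addr_ge0 ?mulr_ge0//; lra.
have [s_eq0|s_neq0] := eqVneq s 0.
  have -> : z = 0 by apply/eqP; rewrite eq_le z0 -s_eq0 zs.
  rewrite addr0 mul0r mulr0 addr0 lerDl mulr_ge0 ?powR_ge0//.
have s_gt0 : 0 < s by rewrite lt_def s_neq0.
have t0 : 0 <= z / s by rewrite divr_ge0.
have t1 : z / s <= 1 by rewrite ler_pdivrMr// mul1r.
have := @convex_powR R q q1 (Itv01 t0 t1) (2 * s) s.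
rewrite !inE /= !in_itv /= !andbT mulr_ge0// s0 => /(_ isT isT).
rewrite [X in (X `^ _ <= _) -> _]convRE convRE /= /unstable.onem.
have -> : z / s * (2 * s) + (1 - z / s) * s = s + z by field.
move/le_trans; apply.
rewrite powRM// -[in leRHS](mulr_powRB1 s0 (lt_le_trans ltr01 q1)).
have -> : z / s * (2 `^ q * s `^ q) = 2 `^ q * (z * s `^ (q - 1)).
  by rewrite -(mulr_powRB1 s0 (lt_le_trans ltr01 q1)); field.
rewrite addrC -addrA lerD//; last by rewrite lerDl mulr_ge0// powR_ge0.
rewrite mulr_powRB1// ?(lt_le_trans ltr01)// ler_piMl ?powR_ge0//; lra.
Qed.

Lemma powRB1_le q s t : 1 <= q -> 0 <= s -> 0 < t ->
  s `^ (q - 1) <= s `^ q / t + t `^ (q - 1).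
Proof.
move=> q1 s0 t0; have q10 : 0 <= q - 1 by rewrite subr_ge0.
have [st|/ltW ts] := leP s t.
  rewrite ler_wpDl ?divr_ge0 ?powR_ge0 ?(ltW t0)//.
  by apply: (ge0_ler_powR q10 _ _ st); rewrite nnegrE//; exact: ltW.
rewrite ler_wpDr ?powR_ge0// ler_pdivlMr// -(mulr_powRB1 s0 (lt_le_trans ltr01 q1)).
by rewrite mulrC ler_wpM2r// powR_ge0.
Qed.

(** The form in which the binomial-type bound is iterated: the cross term is
    absorbed into [s `^ q] up to a factor [z / (2 * t)], which sums to at most
    one half when [t] bounds the sum of the means of the [z]'s. *)
Lemma powR_add_absorb q s z t : 1 <= q -> 0 <= s -> 0 <= z -> 0 < t ->
  (s + z) `^ q <= s `^ q + (2 * t)^-1 * (s `^ q * z) +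
    (2 `^ q * (2 `^ q * (2 * t)) `^ (q - 1)) * z + 2 `^ q * z `^ q.
Proof.
move=> q1 s0 z0 t0; apply: (le_trans (powR_add_le q1 s0 z0)).
have c0 : 0 < 2 `^ q :> R by rewrite powR_gt0.
rewrite lerD2r -addrA lerD2l.
have := powRB1_le q1 s0 (_ : 0 < 2 `^ q * (2 * t)).
move=> /(_ ltac:(by rewrite !mulr_gt0)) h.
apply: (@le_trans _ _ (2 `^ q * (z * (s `^ q / (2 `^ q * (2 * t)) +
    (2 `^ q * (2 * t)) `^ (q - 1))))).
  by rewrite ler_pM2l// ler_wpM2l.
rewrite le_eqVlt; apply/orP; left; apply/eqP; field.
by rewrite !gt_eqF.
Qed.

End powR_inequalities.

Section independent_sums.
Context {d} {T : measurableType d} {R : realType} (P : probability T R).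
Variable xi : nat -> T -> R.
Hypothesis mxi : forall i, measurable_fun [set: T] (xi i).
Hypothesis indep : mutually_independent P xi.
Variable f : nat -> R -> R.
Hypothesis mf : forall i, measurable_fun [set: R] (f i).
Hypothesis f0 : forall i x, 0 <= f i x.

Let S n x := \sum_(i < n) f i (xi i x).

Let mS n : measurable_fun [set: T] (S n).
Proof. by apply: measurable_sum => i; exact: measurableT_comp. Qed.

Let cylinder (J : seq nat) (A : nat -> set R) : set T :=
  \bigcap_(i in [set` J]) (xi i @^-1` A i).

Let mpre (g : T -> R) (A : set R) :
  measurable_fun [set: T] g -> measurable A -> measurable (g @^-1` A).
Proof. by move=> mg mA; rewrite -[X in measurable X]setTI; exact: mg. Qed.

Let mcyl J A : (forall i, i \in J -> measurable (A i)) -> measurable (cylinder J A).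
Proof.
by move=> mA; apply: bigcap_measurableType => i iJ; apply: mpre => //; exact: mA.
Qed.

Let cylinder_cons n J A : cylinder (n :: J) A = xi n @^-1` A n `&` cylinder J A.
Proof.
apply/seteqP; split=> x /=.
  move=> h; split; first by apply: h; rewrite /= mem_head.
  by move=> i iJ; apply: h; rewrite /= in_cons iJ orbT.
by move=> [hn hJ] i /=; rewrite in_cons => /predU1P[->//|]; exact: hJ.
Qed.

(** By induction on the length of the sum: the events in the plane whose preimage
    under [(S n, xi n)] is independent of a fixed cylinder form a Dynkin class
    containing the rectangles, and [S n.+1] is a measurable function of that pair.
    *)
Lemma partial_sum_indep_cylinder n (B : set R) J (A : nat -> set R) :
  measurable B -> uniq J -> (forall i, i \in J -> (n <= i)%N) ->
  (forall i, i \in J -> measurable (A i)) ->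
  (P (S n @^-1` B `&` cylinder J A) = P (S n @^-1` B) * P (cylinder J A))%E.
Proof.
elim: n B J A => [|n IH] B J A mB uJ nJ mA.
  have [B0|B0] := pselect (B 0).
    have -> : S 0 @^-1` B = setT.
      by apply/seteqP; split=> x // _; rewrite /= /S big_ord0.
    by rewrite setTI probability_setT mul1e.
  have -> : S 0 @^-1` B = set0.
    by apply/seteqP; split=> x //; rewrite /= /S big_ord0.
  by rewrite set0I measure0 mul0e.
pose h x := (S n x, xi n x).
have mh : measurable_fun [set: T] h by exact: measurable_fun_pair.
have mhpre C : measurable C -> measurable (h @^-1` C).
  by move=> mC; rewrite -[X in measurable X]setTI; exact: mh.
set E := cylinder J A.
have mE : measurable E by exact: mcyl.
have PE_fin : P E \is a fin_num by exact: fin_num_measure.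
suff key : forall C, measurable C -> (P (h @^-1` C `&` E) = P (h @^-1` C) * P E)%E.
  have mg : measurable_fun [set: R * R] (fun z : R * R => z.1 + f n z.2).
    by apply: measurable_funD => //; exact: measurableT_comp.
  have -> : S n.+1 @^-1` B = h @^-1` ((fun z : R * R => z.1 + f n z.2) @^-1` B).
    by apply/seteqP; split=> x; rewrite /= /S big_ord_recr.
  by apply: key; rewrite -[X in measurable X]setTI; exact: mg.
rewrite measurable_prod_measurableType.
apply: (@dynkin_induction _ (R * R)%type _
    (fun C => P (h @^-1` C `&` E) = P (h @^-1` C) * P E)%E).
- exact: measurable_prod_measurableType.
- move=> _ _ [A1 mA1 [A2 mA2 <-]] [B1 mB1 [B2 mB2 <-]].
  exists (A1 `&` B1); first exact: measurableI.
  exists (A2 `&` B2); first exact: measurableI.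
  by rewrite setXI.
- by rewrite preimage_setT setTI probability_setT mul1e.
- move=> _ [A1 mA1 [A2 mA2 <-]].
  have nJ' : n \notin J by apply/negP => /nJ; rewrite ltnn.
  pose A' i := if i == n then A2 else A i.
  have A'J : cylinder J A' = E.
    apply/seteqP; split=> x Hx i /= iJ; have := Hx i iJ;
      by rewrite /A' (negbTE (memPn nJ' _ iJ)).
  have mA' i : i \in n :: J -> measurable (A' i).
    by rewrite in_cons /A'; case: eqP => //= _; exact: mA.
  have hE : h @^-1` (A1 `*` A2) = S n @^-1` A1 `&` xi n @^-1` A2 by [].
  have A'n : A' n = A2 by rewrite /A' eqxx.
  have -> : h @^-1` (A1 `*` A2) `&` E = S n @^-1` A1 `&` cylinder (n :: J) A'.
    by rewrite cylinder_cons A'J A'n hE setIA.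
  have -> : h @^-1` (A1 `*` A2) = S n @^-1` A1 `&` cylinder [:: n] A'.
    rewrite cylinder_cons A'n hE; congr (_ `&` _).
    by rewrite /cylinder (_ : [set` [::]] = set0) ?bigcap_set0 ?setIT//; apply/seteqP; split.
  rewrite IH//=; last 2 first.
  + by rewrite nJ'.
  + by move=> i; rewrite in_cons => /predU1P[->//|/nJ/ltnW].
  rewrite IH//=; last 2 first.
  + by move=> i; rewrite mem_seq1 => /eqP ->.
  + by move=> i; rewrite mem_seq1 => /eqP ->; apply: mA'; rewrite mem_head.
  rewrite -muleA; congr (_ * _)%E.
  rewrite /cylinder indep//=; last by rewrite nJ'.
  rewrite indep//=; last by move=> i; rewrite mem_seq1 => /eqP ->; apply: mA'; rewrite mem_head.
  rewrite big_cons big_seq1; congr (_ * _)%E.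
  rewrite -A'J /cylinder indep// => i iJ; apply: mA'; by rewrite in_cons iJ orbT.
- move=> C mC PC.
  rewrite preimage_setC setIC -setDE measureD//=; last 2 first.
  + exact: mhpre.
  + by rewrite ltey_eq PE_fin.
  rewrite setIC PC probability_setC; last exact: mhpre.
  by rewrite muleBl ?mul1e// fin_num_adde_defr// fin_num_measure//; exact: mhpre.
- move=> F mF tF PF.
  have tFh : trivIset [set: nat] (fun k => h @^-1` F k).
    apply/trivIsetP => /= i j _ _ ij; rewrite -preimage_setI.
    by move/trivIsetP : tF => /(_ _ _ Logic.I Logic.I ij) ->; rewrite preimage_set0.
  rewrite preimage_bigcup setI_bigcupl.
  rewrite measure_bigcup//=; last 2 first.
  + by move=> i _; apply: measurableI => //; exact: mhpre.
  + exact: trivIset_setIr.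
  rewrite measure_bigcup//=; last by move=> i _; exact: mhpre.
  under eq_eseriesr do rewrite PF muleC.
  by rewrite muleC -(fineK PE_fin) nneseriesZl.
Qed.

Lemma partial_sum_indep_next n (g1 g2 : R -> \bar R) :
  measurable_fun [set: R] g1 -> measurable_fun [set: R] g2 ->
  (forall x, 0 <= g1 x)%E -> (forall x, 0 <= g2 x)%E ->
  (\int[P]_x (g1 (S n x) * g2 (xi n x)) =
   \int[P]_x g1 (S n x) * \int[P]_x g2 (xi n x))%E.
Proof.
move=> mg1 mg2 g10 g20.
pose h x := (S n x, xi n x).
have mh : measurable_fun [set: T] h by exact: measurable_fun_pair.
pose hS : {mfun T >-> R} := HB.pack (S n) (isMeasurableFun.Build _ _ _ _ _ (mS n)).
pose hxi : {mfun T >-> R} := HB.pack (xi n) (isMeasurableFun.Build _ _ _ _ _ (mxi n)).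
pose hh : {mfun T >-> (R * R)%type} := HB.pack h (isMeasurableFun.Build _ _ _ _ _ mh).
pose g (z : R * R) := (g1 z.1 * g2 z.2)%E.
have mg : measurable_fun [set: R * R] g.
  by apply: emeasurable_funM; exact: measurableT_comp.
have g0 z : (0 <= g z)%E by rewrite mule_ge0.
have -> : (\int[P]_x (g1 (S n x) * g2 (xi n x)) = \int[distribution P hh]_z g z)%E.
  by rewrite ge0_integral_distribution.
rewrite (eq_measure_integral (distribution P hS \x distribution P hxi)%E); last first.
  move=> C mC _; apply/esym; apply: product_measure_unique => // A B mA mB.
  rewrite /distribution /pushforward /=.
  have := @partial_sum_indep_cylinder n A [:: n] (fun=> B) mA.
  rewrite cylinder_cons /= /cylinder.
  rewrite (_ : [set` [::]] = set0) ?bigcap_set0 ?setIT; last by apply/seteqP; split.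
  by apply => // i; rewrite mem_seq1 => /eqP ->.
rewrite fubini_tonelli1// /fubini_F /g /=.
under eq_integral do rewrite ge0_integralZl//.
rewrite ge0_integralZr//; last exact: integral_ge0.
by rewrite !ge0_integral_distribution.
Qed.

(** Rosenthal's inequality for nonnegative variables. Writing [t] for the bound
    on the sum of the means, each new summand of mean [s n] multiplies the [q]-th
    moment by at most [1 + s n / (2 * t)], up to terms that add up to a multiple
    of [t `^ q] and of the sum of the individual [q]-th moments. *)
Lemma rosenthal_nonneg (q t wt : R) (s w : nat -> R) :
  1 <= q -> 0 < t ->
  (forall i, 0 <= s i) -> (forall i, 0 <= w i) ->
  (forall i, \int[P]_x (f i (xi i x))%:E <= (s i)%:E)%E ->
  (forall i, \int[P]_x (f i (xi i x) `^ q)%:E <= (w i)%:E)%E ->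
  (forall n, \sum_(i < n) s i <= t) -> (forall n, \sum_(i < n) w i <= wt) ->
  forall n, (\int[P]_x (S n x `^ q)%:E <=
    (2 * (2 `^ q * (2 `^ q * (2 * t)) `^ (q - 1) * t) + 2 * (2 `^ q * wt))%:E)%E.
Proof.
move=> q1 t0 s0 w0 hs hw st wwt.
have q_gt0 : 0 < q by exact: lt_le_trans q1.
set K := 2 `^ q * (2 `^ q * (2 * t)) `^ (q - 1).
set c := 2 `^ q in K *.
have c0 : 0 <= c by rewrite powR_ge0.
have K0 : 0 <= K by rewrite mulr_ge0 ?powR_ge0.
have wt0 : 0 <= wt by have := wwt 0; rewrite big_ord0.
pose u n := (\sum_(i < n) s i) / t.
have u1 n : u n <= 1 by rewrite ler_pdivrMr// mul1r.
have u0 n : 0 <= u n by rewrite divr_ge0 ?sumr_ge0// ltW.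
have S0 n x : 0 <= S n x by rewrite sumr_ge0.
have mpow (g : T -> R) : measurable_fun [set: T] g ->
    measurable_fun [set: T] (fun x => (g x `^ q)%:E).
  move=> mg; apply/measurable_EFinP.
  exact: (measurableT_comp (measurable_powR q) mg).
have mZ n : measurable_fun [set: T] (fun x => f n (xi n x)) by exact: measurableT_comp.
suff H n : (\int[P]_x (S n x `^ q)%:E <=
    (2 * u n * (K * t) + u n * (c * wt) + c * \sum_(i < n) w i)%:E)%E.
  move=> n; apply: (le_trans (H n)); rewrite lee_fin.
  have h1 : 2 * u n * (K * t) <= 2 * (K * t).
    rewrite -mulrA ler_pM2l// ler_piMl// mulr_ge0// ltW//.
  have h2 : u n * (c * wt) <= c * wt by rewrite ler_piMl// mulr_ge0.
  have h3 : c * \sum_(i < n) w i <= c * wt by rewrite ler_wpM2l.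
  lra.
elim: n => [|n IH].
  rewrite /u big_ord0 mul0r !(mulr0, mul0r) big_ord0 mulr0 !addr0.
  under eq_integral do rewrite /S big_ord0 powR0 ?gt_eqF//.
  by rewrite integral0.
apply: (@le_trans _ _ (\int[P]_x ((S n x `^ q)%:E +
    ((2 * t)^-1%:E * ((S n x `^ q)%:E * (f n (xi n x))%:E) +
     (K%:E * (f n (xi n x))%:E + c%:E * (f n (xi n x) `^ q)%:E))))%E).
  apply: ge0_le_integral => //.
  - by move=> x _; rewrite lee_fin powR_ge0.
  - exact: mpow.
  - apply: emeasurable_funD; first exact: mpow.
    apply: emeasurable_funD.
      by apply: emeasurable_funM => //; apply: emeasurable_funM; [exact: mpow|exact/measurable_EFinP].
    by apply: emeasurable_funD; apply: emeasurable_funM => //; [exact/measurable_EFinP|exact: mpow].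
  - move=> x _; rewrite /S big_ord_recr /= -/(S n x) -!EFinM -!EFinD lee_fin !addrA.
    exact: powR_add_absorb.
have t20 : 0 <= (2 * t)^-1 by rewrite invr_ge0 mulr_ge0// ltW.
rewrite ge0_integralD//; last 4 first.
- by move=> x _; rewrite lee_fin powR_ge0.
- exact: mpow.
- by move=> x _; rewrite -!EFinM -!EFinD lee_fin !addr_ge0 ?mulr_ge0 ?powR_ge0.
- apply: emeasurable_funD.
    by apply: emeasurable_funM => //; apply: emeasurable_funM; [exact: mpow|exact/measurable_EFinP].
  by apply: emeasurable_funD; apply: emeasurable_funM => //; [exact/measurable_EFinP|exact: mpow].
rewrite ge0_integralD//; last 4 first.
- by move=> x _; rewrite -!EFinM lee_fin !mulr_ge0 ?powR_ge0.
- by apply: emeasurable_funM => //; apply: emeasurable_funM; [exact: mpow|exact/measurable_EFinP].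
- by move=> x _; rewrite -!EFinM -!EFinD lee_fin !addr_ge0 ?mulr_ge0 ?powR_ge0.
- by apply: emeasurable_funD; apply: emeasurable_funM => //; [exact/measurable_EFinP|exact: mpow].
rewrite ge0_integralD//; last 4 first.
- by move=> x _; rewrite -!EFinM lee_fin !mulr_ge0 ?powR_ge0.
- by apply: emeasurable_funM => //; exact/measurable_EFinP.
- by move=> x _; rewrite -!EFinM lee_fin !mulr_ge0 ?powR_ge0.
- by apply: emeasurable_funM => //; exact: mpow.
rewrite !ge0_integralZl//; last 6 first.
- exact: mpow.
- by move=> x _; rewrite lee_fin powR_ge0.
- exact/measurable_EFinP.
- by move=> x _; rewrite lee_fin.
- by apply: emeasurable_funM; [exact: mpow|exact/measurable_EFinP].
- by move=> x _; rewrite -!EFinM lee_fin !mulr_ge0 ?powR_ge0.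
rewrite (@partial_sum_indep_next n (fun y => (y `^ q)%:E) (fun y => (f n y)%:E))//; last 4 first.
- by apply/measurable_EFinP; exact: measurable_powR.
- exact/measurable_EFinP.
- by move=> x; rewrite lee_fin powR_ge0.
- by move=> x; rewrite lee_fin.
set a := (\int[P]_x (S n x `^ q)%:E)%E in IH *.
have a0 : (0 <= a)%E by apply: integral_ge0 => x _; rewrite lee_fin powR_ge0.
apply: (@le_trans _ _ (a + ((2 * t)^-1%:E * (a * (s n)%:E) + (K%:E * (s n)%:E + c%:E * (w n)%:E)))%E).
  apply: leeD => //; apply: leeD; first by rewrite lee_wpmul2l// lee_wpmul2l.
  by apply: leeD; rewrite lee_wpmul2l.
have af : a \is a fin_num by rewrite ge0_fin_numE// (le_lt_trans IH) ?ltry.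
move: IH; rewrite -(fineK af); set b := fine a => IH.
rewrite -!EFinM -!EFinD lee_fin; rewrite lee_fin in IH.
rewrite /u !big_ord_recr /= -/(S n).
have -> : (\sum_(i < n) s i + s n) / t = u n + s n / t by rewrite mulrDl.
have v0 : 0 <= s n / t by rewrite divr_ge0// ltW.
have -> : (2 * t)^-1 * (b * s n) = (s n / t) * (b / 2).
  by field; rewrite gt_eqF.
have -> : K * s n = (s n / t) * (K * t) by field; rewrite gt_eqF.
have b2 : b / 2 <= K * t + c * wt.
  have h1 : 2 * u n * (K * t) <= 2 * (K * t).
    by rewrite -mulrA ler_pM2l// ler_piMl// mulr_ge0// ltW.
  have h2 : u n * (c * wt) <= c * wt by rewrite ler_piMl// mulr_ge0.
  have h3 : c * \sum_(i < n) w i <= c * wt by rewrite ler_wpM2l.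
  rewrite ler_pdivrMr//; lra.
have := ler_wpM2l v0 b2.
have -> : 2 * (u n + s n / t) * (K * t) = 2 * u n * (K * t) + 2 * (s n / t * (K * t)) by ring.
rewrite !mulrDr !mulrDl; lra.
Qed.

End independent_sums.

(** * Moments of the distance to the leading eigenspace *)

Section polynomial_tail.
Context {R : realType}.

Lemma powR_le_base (r x y : R) : 0 <= r -> 0 <= x -> x <= y -> x `^ r <= y `^ r.
Proof.
by move=> r0 x0 xy; apply: ge0_ler_powR => //; rewrite nnegrE// (le_trans x0).
Qed.

Lemma powR_telescope (x s : R) : 0 < x -> 0 < s ->
  s * (x + 1) `^ (- (s + 1)) <= x `^ (- s) - (x + 1) `^ (- s).
Proof.
move=> x0 s0.
have x10 : 0 < x + 1 by rewrite addr_gt0.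
have -> : x `^ (- s) = (x + 1) `^ (- s) * expR (- s * ln (x / (x + 1))).
  rewrite !/powR !gt_eqF// -expRD ln_div ?posrE//; congr expR; ring.
have -> : (x + 1) `^ (- (s + 1)) = (x + 1) `^ (- s) / (x + 1).
  rewrite opprD powRD; last by rewrite (gt_eqF x10) implybT.
  by rewrite (powR_inv1 (ltW x10)).
have pw0 : 0 < (x + 1) `^ (- s) by rewrite powR_gt0.
rewrite mulrCA -[X in _ - X]mulr1 -mulrBr ler_pM2l//.
have h1 : ln (x / (x + 1)) <= - (x + 1)^-1.
  have -> : x / (x + 1) = 1 + - (x + 1)^-1 by field; rewrite gt_eqF.
  apply: le_ln1Dx; rewrite ltrN2 invf_lt1//; lra.
have h2 := expR_ge1Dx (- s * ln (x / (x + 1))).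
have h3 : s * (x + 1)^-1 <= - s * ln (x / (x + 1)).
  by rewrite mulNr -mulrN ler_pM2l// lerNr.
lra.
Qed.

Lemma sum_powR_tail (tau : R) (d n : nat) : 1 < tau -> (0 < d)%N ->
  \sum_(i < n) (if (i < d)%N then 0 else i.+1%:R `^ (- tau)) <=
    d%:R `^ (1 - tau) / (tau - 1).
Proof.
move=> tau1 d0; have s0 : 0 < tau - 1 by rewrite subr_gt0.
suff H : \sum_(i < n) (if (i < d)%N then 0 else i.+1%:R `^ (- tau)) <=
    if (n <= d)%N then 0 else (d%:R `^ (1 - tau) - n%:R `^ (1 - tau)) / (tau - 1).
  apply: (le_trans H); case: ifP => _; first by rewrite divr_ge0 ?powR_ge0// ltW.
  by rewrite ler_pM2r ?invr_gt0// gerBl powR_ge0.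
elim: n => [|n IH]; first by rewrite big_ord0 leq0n.
rewrite big_ord_recr /=; have [nd|dn] := ltnP n d.
  by rewrite addr0 (le_trans IH)// (ltnW nd).
have n0 : 0 < n%:R :> R by rewrite ltr0n (leq_trans d0).
have := powR_telescope n0 s0; rewrite opprB subrK -natr1 => h.
have {}IH : \sum_(i < n) (if (i < d)%N then 0 else i.+1%:R `^ (- tau)) <=
    (d%:R `^ (1 - tau) - n%:R `^ (1 - tau)) / (tau - 1).
  apply: (le_trans IH); case: ifP => // nd; rewrite (_ : n = d) ?subrr ?mul0r//.
  by apply/eqP; rewrite eqn_leq nd.
rewrite ler_pdivlMr// in IH; rewrite ler_pdivlMr// mulrDl.
lra.
Qed.

Lemma near_natpowR_ge (r K : R) : 0 < r -> \forall d \near \oo, K <= d%:R `^ r.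
Proof.
move=> r0; near=> d.
apply: (le_trans (ler_norm K)).
have -> : `|K| = (`|K| `^ r^-1) `^ r by rewrite -powRrM mulVf ?gt_eqF// powRr1.
apply: powR_le_base; [exact: ltW|exact: powR_ge0|].
near: d; exact: nbhs_infty_ger.
Unshelve. all: by end_near. Qed.

End polynomial_tail.

Section projection.
Context {R : realType} {X : hilbertType R} (phi : nat -> X).

Definition proj (d : nat) (x : X) : X := \sum_(i < d) inner x (phi i) *: phi i.

Hypothesis phi_basis : orthonormal_basis setT phi.

Lemma inner_proj d x i :
  inner (proj d x) (phi i) = if (i < d)%N then inner x (phi i) else 0.
Proof.
rewrite inner_suml; case: ifP => id.
  rewrite (bigD1 (Ordinal id))//= innerZl (phi_basis.1)// eqxx mulr1 big1 ?addr0//.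
  move=> j ji; rewrite innerZl (phi_basis.1)//.
  by rewrite (negbTE (ji : (j != i :> nat))) mulr0.
apply: big1 => j _; rewrite innerZl (phi_basis.1)//.
by case: eqP => [ji|_]; [rewrite -ji ltn_ord in id|rewrite mulr0].
Qed.

Lemma norm_sub_proj_le d x : `|x - proj d x| <= `|x|.
Proof.
rewrite -(@ler_pXn2r _ 2) ?nnegrE// sqr_normB.
have -> : `|proj d x| ^+ 2 = inner x (proj d x).
  rewrite -inner_norm {1}/proj inner_suml inner_sumr; apply: eq_bigr => i _.
  by rewrite innerZl innerZr [inner (phi i) _]innerC inner_proj ltn_ord.
have : 0 <= inner x (proj d x).
  rewrite inner_sumr sumr_ge0// => i _; rewrite innerZr -expr2 sqr_ge0//.
lra.
Qed.

Lemma continuous_tail d : continuous (fun x => `|x - proj d x|).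
Proof.
apply: (@lipschitz_continuous _ _ _ _ 1) => x y; rewrite mul1r.
apply: (le_trans (ler_dist_dist _ _)).
have -> : x - proj d x - (y - proj d y) = (x - y) - proj d (x - y).
  have -> : proj d (x - y) = proj d x - proj d y.
    by rewrite /proj -sumrB; apply: eq_bigr => i _; rewrite innerBl scalerBl.
  by rewrite !opprD !opprK addrACA.
exact: norm_sub_proj_le.
Qed.

Lemma measurable_tail d : measurable_fun [set: borel X]
  (fun x : borel X => `|(x : X) - proj d x|).
Proof. by apply: continuous_borel; exact: continuous_tail. Qed.

(** Halving the square leaves room to pass from the infinite Parseval sum to a
    finite partial sum. *)
Lemma tail_le_partial_sum d x : exists n,
  `|x - proj d x| ^+ 2 / 2 <=
    \sum_(i < n) (if (i < d)%N then 0 else inner x (phi i) ^+ 2).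
Proof.
set y := x - proj d x.
have [->|y0] := eqVneq y 0; first by exists 0; rewrite normr0 expr0n mul0r big_ord0.
have yy : `|y| ^+ 2 / 2 < `|y| ^+ 2.
  by have : 0 < `|y| ^+ 2 by [rewrite exprn_gt0 ?normr_gt0]; lra.
have E i : inner y (phi i) ^+ 2 = if (i < d)%N then 0 else inner x (phi i) ^+ 2.
  rewrite /y innerBl inner_proj; case: ifP => _; last by rewrite subr0.
  by rewrite subrr expr0n.
apply: contrapT => /forallNP H.
have := parseval_le y phi_basis.
apply/negP; rewrite -ltNge.
apply: (@le_lt_trans _ _ (`|y| ^+ 2 / 2)%:E); last by rewrite lte_fin.
under eq_eseriesl do rewrite in_setT.
apply: lime_le; first by apply: is_cvg_nneseries => i _ _; rewrite lee_fin sqr_ge0.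
near=> n; rewrite big_mkord sumEFin lee_fin.
under eq_bigr do rewrite E.
by rewrite ltW// ltNge; apply/negP/H.
Unshelve. all: by end_near. Qed.

End projection.

(** An upper bound on the sum of [i.+1 `^ (- tau)] over [i >= d]. *)
Definition powR_tail {R : realType} (tau : R) (d : nat) : R :=
  d%:R `^ (1 - tau) / (tau - 1).

(** The factor of [t `^ q] in Rosenthal's inequality when the sum of the [q]-th
    moments does not exceed [t `^ q]. *)
Definition rosenthal_const {R : realType} (q : R) : R :=
  2 * (2 `^ q * (2 `^ q * 2) `^ (q - 1)) + 2 * 2 `^ q.

Section tail_moments.
Context {R : realType} {X : hilbertType R} (mu : probability (borel X) R).
Variables (p tau a b : R) (phi : nat -> X).
Hypothesis tau1 : 1 < tau.
Hypothesis p1 : 1 <= p.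
Let lam (i : nat) : R := i.+1%:R `^ (- tau).
Hypothesis cond : measure_conditions mu p lam phi a b.
Let xi := coordinate lam phi.
Let P : R := Num.max p 2.
Let q : R := P / 2.

Let lam0 i : 0 < lam i. Proof. exact: (cond_lambda_gt0 cond). Qed.

Lemma measurable_coordinate i : measurable_fun [set: borel X] (xi i).
Proof.
by apply: measurable_funM => //; exact: measurable_inner.
Qed.

Lemma coordinate_sqr i x : lam i * xi i x ^+ 2 = inner (x : X) (phi i) ^+ 2.
Proof.
rewrite /xi /coordinate expr_div_n sqr_sqrtr ?ltW//.
by rewrite mulrCA divff ?mulr1// gt_eqF.
Qed.

Lemma integral_inner_sqr i : (\int[mu]_x (inner (x : X) (phi i) ^+ 2)%:E = (lam i)%:E)%E.
Proof.
have [C [covC eigC]] := cond_eigen cond.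
under eq_integral do rewrite expr2.
rewrite covC eigC innerZl ((cond_basis cond).1)// eqxx mulr1//.
Qed.

Let P2 : 2 <= P. Proof. by rewrite le_max lexx orbT. Qed.
Let q1 : 1 <= q. Proof. by rewrite /q ler_pdivlMr// mul1r. Qed.
Let q0 : 0 < q. Proof. exact: lt_le_trans q1. Qed.

Lemma integral_coordinate_sqr i : (\int[mu]_x (xi i x ^+ 2)%:E = 1)%E.
Proof.
have li : lam i != 0 by rewrite gt_eqF.
have -> : (fun x => (xi i x ^+ 2)%:E) =
    (fun x : borel X => ((lam i)^-1)%:E * (inner (x : X) (phi i) ^+ 2)%:E)%E.
  by apply/funext => x; rewrite -EFinM -coordinate_sqr mulKf.
rewrite ge0_integralZl//; last 3 first.
- by apply/measurable_EFinP; apply: measurable_funX; exact: measurable_inner.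
- by move=> x _; rewrite lee_fin sqr_ge0.
- by rewrite lee_fin invr_ge0 ltW.
by rewrite integral_inner_sqr -EFinM mulVf.
Qed.

Lemma powR_sqr_half (x : R) : (x ^+ 2) `^ q = `|x| `^ P.
Proof.
rewrite -(real_normK (num_real x)) -powR_mulrn// -powRrM; congr (_ `^ _).
by rewrite /q mulrCA divff ?mulr1.
Qed.

(** When [P = 2] the bound must be the exact value [1], as no power of the
    dimension is left to absorb a larger constant. *)
Lemma coordinate_moment : exists2 M : R, 0 <= M & (P = 2 -> M = 1) /\
  forall i, (\int[mu]_x (`|xi i x| `^ P)%:E <= M%:E)%E.
Proof.
have [PE|Pn2] := eqVneq P 2.
  exists 1 => //; split => // i.
  have -> : (fun x => (`|xi i x| `^ P)%:E) = (fun x => (xi i x ^+ 2)%:E).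
    by apply/funext => x; rewrite PE powR_mulrn// real_normK ?num_real.
  by rewrite integral_coordinate_sqr.
have := cond_moments cond; rewrite -/P -/xi.
set s := ereal_sup _ => s_lt.
have s0 : (0 <= s)%E.
  by apply: (@le_trans _ _ ('N[mu]_P%:E [EFin \o xi 0])%E);
    [exact: Lnorm_ge0|apply: ereal_sup_ubound; exists 0].
have sf : s \is a fin_num by rewrite ge0_fin_numE.
exists (fine s `^ P); first exact: powR_ge0.
split; first by move/eqP; rewrite (negbTE Pn2).
move=> i.
have P_neq0 : P != 0 by rewrite gt_eqF// (lt_le_trans _ P2).
have -> : (\int[mu]_x (`|xi i x| `^ P)%:E = 'N[mu]_P%:E [EFin \o xi i] `^ P)%E.
  by rewrite poweR_Lnorm//; apply: eq_integral.
rewrite -poweR_EFin fineK//; apply: gt0_ler_poweR => //.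
- by rewrite (le_trans _ P2).
- by rewrite in_itv /= Lnorm_ge0 leey.
- by rewrite in_itv /= s0 leey.
- by apply: ereal_sup_ubound; exists i.
Qed.

Local Notation ros_q := (rosenthal_const q).
Local Notation tail_mean := (powR_tail tau).

(** The variances of the neglected coordinates add up to about [d `^ (1 - tau)],
    and the sum of their [q]-th powers is smaller than the [q]-th power of this sum
    by a factor of order [d `^ (1 - q)]. For large [d] this factor absorbs the bound
    on the moments of the [xi i], and what remains in front of the [q]-th power of
    the tail depends on [p] only. *)
Lemma tail_moment : \forall d \near \oo,
  (\int[mu]_x (`|(x : X) - proj phi d x| `^ P)%:E <=
   (2 `^ q * (ros_q * tail_mean d `^ q))%:E)%E.
Proof.
have [M M0 [M1 momM]] := coordinate_moment.
have s0 : 0 < tau - 1 by rewrite subr_gt0.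
have tm0 d : (0 < d)%N -> 0 < tail_mean d.
  by move=> d0; rewrite divr_gt0 ?powR_gt0 ?ltr0n.
have dM : \forall d \near \oo, (0 < d)%N /\ M * (tau - 1) `^ (q - 1) <= d%:R `^ (q - 1).
  have [qE|qn1] := eqVneq q 1.
    near=> d; split; first by near: d; exact: nbhs_infty_gt.
    rewrite qE subrr !powRr0 mulr1 M1//.
    by move: qE; rewrite /q => /divr1_eq.
  have q10 : 0 < q - 1 by rewrite subr_gt0 lt_def qn1.
  by apply: filterI; [exact: nbhs_infty_gt|exact: near_natpowR_ge].
near=> d.
have [d0 Md] : (0 < d)%N /\ M * (tau - 1) `^ (q - 1) <= d%:R `^ (q - 1) by near: d.
pose f i (y : R) := if (i < d)%N then 0 else lam i * y ^+ 2.
pose s i := if (i < d)%N then 0 else lam i.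
pose w i := if (i < d)%N then 0 else lam i `^ q * M.
have mf i : measurable_fun [set: R] (f i).
  rewrite /f; case: (i < d)%N; first exact: measurable_cst.
  by apply: measurable_funM => //; exact: measurable_funX.
have f0 i y : 0 <= f i y by rewrite /f; case: ifP => // _; rewrite mulr_ge0 ?sqr_ge0// ltW.
have t0 := tm0 d d0.
have st n : \sum_(i < n) s i <= tail_mean d by exact: sum_powR_tail.
have wt n : \sum_(i < n) w i <= tail_mean d `^ q.
  have lamd i : (d <= i)%N -> lam i `^ (q - 1) * M <= tail_mean d `^ (q - 1).
    move=> di.
    have q10 : 0 <= q - 1 by rewrite subr_ge0.
    have h : lam i <= d%:R `^ (- tau).
      rewrite /lam !powRN lef_pV2 ?posrE ?powR_gt0 ?ltr0n//.
      apply: powR_le_base => //; first by rewrite (le_trans _ (ltW tau1)).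
      by rewrite ler_nat (leq_trans di).
    apply: (@le_trans _ _ ((d%:R `^ (- tau)) `^ (q - 1) * M)).
      exact: (ler_wpM2r M0 (powR_le_base q10 (ltW (lam0 i)) h)).
    have -> : tail_mean d = d%:R `^ (- tau) * (d%:R / (tau - 1)).
      rewrite /powR_tail addrC powRD ?powRr1 ?mulrA//.
      by rewrite pnatr_eq0 -lt0n d0 implybT.
    rewrite powRM ?powR_ge0//; last by rewrite divr_ge0// ltW.
    rewrite ler_wpM2l ?powR_ge0// powRM ?invr_ge0 ?(ltW s0)//.
    rewrite -[(tau - 1)^-1](powR_inv1 (ltW s0)) powRAC powR_inv1 ?powR_ge0//.
    by rewrite ler_pdivlMr// powR_gt0.
  apply: (@le_trans _ _ (\sum_(i < n) tail_mean d `^ (q - 1) * s i)).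
    apply: ler_sum => i _; rewrite /w /s; case: ltnP => di; first by rewrite mulr0.
    rewrite -(mulr_powRB1 (ltW (lam0 i)) q0) -mulrA [leRHS]mulrC.
    exact: (ler_wpM2l (ltW (lam0 i)) (lamd i di)).
  rewrite -mulr_sumr -(mulr_powRB1 (ltW t0) q0) mulrC ler_wpM2r ?powR_ge0//.
have ros := @rosenthal_nonneg _ _ _ mu xi measurable_coordinate (cond_indep cond) f mf f0
  q (tail_mean d) (tail_mean d `^ q) s w q1 t0.
have {}ros n : (\int[mu]_x ((\sum_(i < n) f i (xi i x)) `^ q)%:E <=
    (ros_q * tail_mean d `^ q)%:E)%E.
  apply: (le_trans (ros _ _ _ _ st wt n)).
  - by move=> i; rewrite /s; case: ifP => // _; exact: ltW.
  - by move=> i; rewrite /w; case: ifP => // _; rewrite mulr_ge0 ?powR_ge0.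
  - move=> i; rewrite /f /s; case: ifP => _; first by rewrite integral0.
    by under eq_integral do rewrite coordinate_sqr; rewrite integral_inner_sqr.
  - move=> i; rewrite /f /w; case: ifP => _.
      by under eq_integral do rewrite powR0 ?gt_eqF//; rewrite integral0.
    under eq_integral do rewrite powRM ?sqr_ge0 ?ltW// powR_sqr_half EFinM.
    rewrite ge0_integralZl//; last 2 first.
    + apply/measurable_EFinP.
      apply: (measurableT_comp (measurable_powR P)).
      by apply: measurableT_comp => //; exact: measurable_coordinate.
    + by rewrite lee_fin powR_ge0.
    by rewrite EFinM lee_wpmul2l// lee_fin powR_ge0.
  - rewrite lee_fin le_eqVlt; apply/orP; left; apply/eqP.
    rewrite /rosenthal_const [2 `^ q * (2 * tail_mean d)]mulrA (powRM _ (mulr_ge0 (powR_ge0 _ _) (ler0n _ 2)) (ltW t0)).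
    by rewrite -(mulr_powRB1 (ltW t0) q0); ring.
pose S n (x : borel X) := \sum_(i < n) f i (xi i x).
have S0 n x : 0 <= S n x by rewrite sumr_ge0.
have mS n : measurable_fun [set: borel X] (S n).
  by apply: measurable_sum => i; apply: measurableT_comp => //; exact: measurable_coordinate.
have mSq n : measurable_fun [set: borel X] (fun x => (S n x `^ q)%:E).
  by apply/measurable_EFinP; exact: (measurableT_comp (measurable_powR q) (mS n)).
have ndS x : {homo (fun n => (S n x `^ q)%:E) : n m / (n <= m)%N >-> (n <= m)%E}.
  apply/nondecreasing_seqP => n; rewrite lee_fin; apply: powR_le_base => //; first exact: ltW.
  by rewrite /S big_ord_recr /= lerDl.
have cvgS x : cvg ((fun n => (S n x `^ q)%:E) @ \oo).
  exact: ereal_nondecreasing_is_cvgn.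
apply: (@le_trans _ _ (\int[mu]_x ((2 `^ q)%:E * limn (fun n => (S n x `^ q)%:E)))%E).
  apply: ge0_le_integral => //.
  - apply/measurable_EFinP; apply: (measurableT_comp (measurable_powR P)).
    exact: (measurable_tail (cond_basis cond)).
  - apply: emeasurable_funM => //.
    by apply: (@emeasurable_fun_cvg _ _ _ _ (fun n x => (S n x `^ q)%:E)).
  - move=> x _.
    have [n hn] := tail_le_partial_sum (cond_basis cond) d (x : X).
    have {}hn : `|(x : X) - proj phi d x| ^+ 2 / 2 <= S n x.
      apply: (le_trans hn); rewrite le_eqVlt; apply/orP; left; apply/eqP.
      by apply: eq_bigr => i _; rewrite /f; case: ifP => // _; rewrite coordinate_sqr.
    apply: (@le_trans _ _ ((2 `^ q)%:E * (S n x `^ q)%:E)%E).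
      rewrite -EFinM lee_fin -powRM// -[X in X `^ P]normr_id -powR_sqr_half.
      apply: powR_le_base; [exact: ltW|exact: sqr_ge0|].
      by rewrite mulrC -ler_pdivrMr.
    rewrite lee_wpmul2l ?lee_fin ?powR_ge0//.
    by apply: lime_ge => //; exists n => // m /= nm; exact: ndS.
rewrite ge0_integralZl//; last 2 first.
- by apply: (@emeasurable_fun_cvg _ _ _ _ (fun n x => (S n x `^ q)%:E)).
- by move=> x _; apply: lime_ge => //; apply: nearW => n; rewrite lee_fin powR_ge0.
rewrite EFinM lee_wpmul2l ?lee_fin ?powR_ge0//.
rewrite monotone_convergence//; last first.
  by move=> n x _; rewrite lee_fin powR_ge0.
apply: lime_le; last by apply: nearW => n; exact: ros.
apply: ereal_nondecreasing_is_cvgn => n m nm; apply: ge0_le_integral => //.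
- by move=> x _; rewrite lee_fin powR_ge0.
- by move=> x _; exact: ndS.
Unshelve. all: by end_near. Qed.

End tail_moments.

(** * The loss of an estimator as a measurable function of the data *)

Section real_Lnorm.
Context {d} {T : measurableType d} {R : realType} (P : probability T R) (p : R).
Hypothesis p1 : 1 <= p.
Implicit Types f g : T -> R.

Let p0 : 0 < p. Proof. exact: lt_le_trans p1. Qed.
Let pinv0 : 0 <= p^-1. Proof. by rewrite invr_ge0 ltW. Qed.

Lemma measurable_powR_norm f : measurable_fun [set: T] f ->
  measurable_fun [set: T] (fun x => (`|f x| `^ p)%:E).
Proof.
move=> mf; apply/measurable_EFinP.
by apply: (measurableT_comp (measurable_powR p)); exact: measurableT_comp.
Qed.

Lemma Lnorm_integral f :
  ('N[P]_p%:E[EFin \o f] =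
   (\int[P]_x (`|f x| `^ p)%:E) `^ p^-1)%E.
Proof. by rewrite unlock; congr (_ `^ _)%E; apply: eq_integral. Qed.

Lemma Lnorm_le_mono f g : measurable_fun [set: T] f -> measurable_fun [set: T] g ->
  (forall x, `|f x| <= `|g x|) ->
  ('N[P]_p%:E[EFin \o f] <= 'N[P]_p%:E[EFin \o g])%E.
Proof.
move=> mf mg fg; rewrite !Lnorm_integral.
have h0 (h : T -> R) : (0 <= \int[P]_x (`|h x| `^ p)%:E)%E.
  by apply: integral_ge0 => x _; rewrite lee_fin powR_ge0.
apply: gt0_ler_poweR; rewrite ?in_itv /= ?h0 ?leey//.
apply: ge0_le_integral => //.
- exact: measurable_powR_norm.
- exact: measurable_powR_norm.
- by move=> x _; rewrite lee_fin; apply: powR_le_base => //; exact: ltW.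
Qed.

Lemma Lnorm_le_of_integral f (K : R) : 0 <= K ->
  (\int[P]_x (`|f x| `^ p)%:E <= (K `^ p)%:E)%E ->
  ('N[P]_p%:E[EFin \o f] <= K%:E)%E.
Proof.
move=> K0 h; rewrite Lnorm_integral.
have -> : K%:E = ((K `^ p)%:E `^ p^-1)%E.
  by rewrite poweR_EFin -powRrM mulfV ?gt_eqF// powRr1.
apply: gt0_ler_poweR => //; rewrite ?in_itv /= ?leey ?lee_fin ?powR_ge0//.
by rewrite andbT; apply: integral_ge0 => x _; rewrite lee_fin powR_ge0.
Qed.

Lemma Lnorm_ge_of_integral f (K : R) : 0 <= K ->
  ((K `^ p)%:E <= \int[P]_x (`|f x| `^ p)%:E)%E ->
  (K%:E <= 'N[P]_p%:E[EFin \o f])%E.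
Proof.
move=> K0 h; rewrite Lnorm_integral.
have -> : K%:E = ((K `^ p)%:E `^ p^-1)%E.
  by rewrite poweR_EFin -powRrM mulfV ?gt_eqF// powRr1.
apply: gt0_ler_poweR => //; rewrite ?in_itv /= ?leey ?lee_fin ?powR_ge0//.
by rewrite andbT; apply: integral_ge0 => x _; rewrite lee_fin powR_ge0.
Qed.

Lemma Lnorm_le_bound f (K : R) : measurable_fun [set: T] f ->
  (forall x, `|f x| <= K) -> ('N[P]_p%:E[EFin \o f] <= K%:E)%E.
Proof.
move=> mf fK; have K0 : 0 <= K by rewrite (le_trans _ (fK point)).
apply: Lnorm_le_of_integral => //.
rewrite -(integral_probability_cst P); apply: ge0_le_integral => //.
- exact: measurable_powR_norm.
- by move=> x _; rewrite lee_fin; apply: powR_le_base => //; exact: ltW.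
Qed.

End real_Lnorm.

Section loss.
Context {R : realType} {X Y : hilbertType R} (mu : probability (borel X) R) (p : R).
Hypothesis p1 : 1 <= p.
Hypothesis sepY : separable_space Y.
Implicit Types F G H : X -> Y.

Let meas F := measurable_fun [set: borel X] (F : borel X -> borel Y).

Lemma measurable_norm_diff F G : meas F -> meas G ->
  measurable_fun [set: borel X] (fun x : borel X => `|F x - G x|).
Proof.
move=> mF mG; apply: (measurableT_comp measurable_hnorm).
apply: (measurable_hadd sepY) => //.
under eq_fun do rewrite -scaleN1r.
exact: (measurable_hscale (-1) mG).
Qed.

Lemma Lp_dist_triangle F G H : meas F -> meas G -> meas H ->
  (Lp_dist mu p F H <= Lp_dist mu p F G + Lp_dist mu p G H)%E.
Proof.
move=> mF mG mH.
have mFG := measurable_norm_diff mF mG.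
have mGH := measurable_norm_diff mG mH.
apply: le_trans (minkowski_EFin mu mFG mGH p1).
rewrite /Lp_dist /Lp_norm; apply: Lnorm_le_mono => //.
- exact: measurable_norm_diff.
- exact: measurable_funD.
move=> x /=; rewrite !normr_id [leRHS]ger0_norm ?addr_ge0//.
by rewrite -[F x - H x](subrKA (G x)) ler_normD.
Qed.

Lemma Lp_dist_sym F G : Lp_dist mu p F G = Lp_dist mu p G F.
Proof.
by rewrite /Lp_dist /Lp_norm; congr Lnorm; apply/funext => x; rewrite distrC.
Qed.

Lemma lipschitz_measurable F (L : R) :
  (forall x x', `|F x - F x'| <= L * `|x - x'|) -> meas F.
Proof. by move=> FL; apply: continuous_borel_borel; exact: lipschitz_continuous FL. Qed.

Lemma FBL_measurable F (B L : R) : FBL B L F -> meas F.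
Proof. by move=> [_ FL]; exact: lipschitz_measurable FL. Qed.

Lemma bounded_Lp F (K : R) : meas F -> (forall x, `|F x| <= K) -> Lp mu p F.
Proof.
move=> mF FK; split => //; apply: le_lt_trans (ltry K).
apply: Lnorm_le_bound => //; first exact: (measurableT_comp measurable_hnorm mF).
by move=> x; rewrite normr_id.
Qed.

(** Balls of the [L^p] pseudo-distance are open, so the very definition of an
    estimator makes its distance to a fixed function measurable. *)
Lemma measurable_loss {d} {D : measurableType d} (Fhat : D -> X -> Y) F :
  estimator mu p D Fhat -> Lp mu p F ->
  measurable_fun [set: D] (fun t => Lp_dist mu p F (Fhat t)).
Proof.
move=> [LpFhat mFhat] [mF _].
apply: (measurability _ (ErealGenInftyO.measurableE R)) => //.
move=> _ [_ [r ->] <-]; rewrite setTI.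
have -> : (fun t => Lp_dist mu p F (Fhat t)) @^-1` `]-oo, r%:E[%classic =
    Fhat @^-1` [set G | (Lp_dist mu p F G < r%:E)%E].
  by apply/seteqP; split => t /=; rewrite in_itv.
apply: mFhat => G [mG _] /= Gr.
have G0 : (0 <= Lp_dist mu p F G)%E by exact: Lnorm_ge0.
have Gf : Lp_dist mu p F G \is a fin_num by rewrite ge0_fin_numE// (lt_trans Gr)// ltry.
exists (r - fine (Lp_dist mu p F G)).
  by rewrite subr_gt0 -lte_fin fineK.
move=> H [mH _] GH /=.
apply: (le_lt_trans (Lp_dist_triangle mF mG mH)).
by rewrite -(fineK Gf) -lteBrDl// EFinB.
Qed.

Context {n : nat} (sigma : R).

Lemma measurable_observe {d} {D : measurableType d} F
    (x : D -> n.-tuple (borel X)) (e : D -> n.-tuple (borel Y)) :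
  meas F -> measurable_fun [set: D] x -> measurable_fun [set: D] e ->
  measurable_fun [set: D] (fun w => observe sigma F (x w) (e w)).
Proof.
move=> mF mx me; apply/measurable_fun_tnthP => i.
have mxi : measurable_fun [set: D] (fun w => tnth (x w) i : borel X).
  exact: (measurableT_comp (measurable_tnth i) mx).
have mei : measurable_fun [set: D] (fun w => tnth (e w) i : borel Y).
  exact: (measurableT_comp (measurable_tnth i) me).
rewrite (_ : _ \o _ = fun w =>
  (tnth (x w) i : borel X, (F (tnth (x w) i) + sigma *: (tnth (e w) i : Y)) : borel Y)); last first.
  by apply/funext => w /=; rewrite tnth_mktuple.
apply: measurable_fun_pair => //.
apply: (measurable_hadd sepY); first exact: (measurableT_comp mF mxi).
exact: (measurable_hscale sigma mei).
Qed.

End loss.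

(** * Risk of a cellwise averaging estimator *)

Section step_functions.
Context {R : realType} {X Y : hilbertType R} (mu : probability (borel X) R) (p : R).
Hypothesis p1 : 1 <= p.
Hypothesis sepY : separable_space Y.
Variables (C : finType) (A : C -> set X).
Hypothesis mA : forall c, measurable (A c : set (borel X)).

Definition step_fun (v : C -> Y) (x : X) : Y := \sum_c (\1_(A c) x : R) *: v c.

Lemma measurable_step_fun v :
  measurable_fun [set: borel X] (step_fun v : borel X -> borel Y).
Proof.
apply: (measurable_hsum sepY) => c.
have mi : measurable_fun [set: borel X] (\1_(A c) : borel X -> R).
  exact: measurable_indic.
exact: (measurableT_comp (measurable_hscalel (v c)) mi).
Qed.

Lemma step_fun_le v v' (r : R) : (forall c, `|v c - v' c| <= r) ->
  forall x, `|step_fun v x - step_fun v' x| <= #|C|%:R * r.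
Proof.
move=> vv' x; rewrite -sumrB (le_trans (ler_norm_sum _ _ _))//.
rewrite mulr_natl -sumr_const; apply: ler_sum => c _.
rewrite -scalerBr normrZ indicE.
case: (x \in A c); rewrite ?normr1 ?mul1r ?normr0 ?mul0r//.
exact: le_trans (vv' c).
Qed.

Lemma step_fun_Lp v : Lp mu p (step_fun v).
Proof.
apply: (@bounded_Lp _ _ _ mu p p1 _ (#|C|%:R * \sum_c `|v c|)).
  exact: measurable_step_fun.
move=> x; have -> : step_fun v x = step_fun v x - step_fun (fun=> 0) x.
  by rewrite [X in _ - X]big1 ?subr0// => c _; rewrite scaler0.
apply: step_fun_le => c; rewrite subr0 (bigD1 c)//= lerDl sumr_ge0//.
Qed.

(** A step function depends continuously in [L^p] on its finitely many values, so
    that an [L^p]-open set of step functions is an open set of families of values. *)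
Lemma step_estimator {d} {D : measurableType d} (v : C -> D -> Y) :
  (forall c, measurable_fun [set: D] (v c : D -> borel Y)) ->
  estimator mu p D (fun t => step_fun (fun c => v c t)).
Proof.
move=> mv; split; first by move=> t; exact: step_fun_Lp.
move=> U oU.
apply: (measurable_open_family sepY (f := v) (W := fun w => U (step_fun w))) => // w Uw.
have [e e0 eU] := oU _ (step_fun_Lp w) Uw.
have k0 : 0 < #|C|.+1%:R :> R by [].
exists (e / #|C|.+1%:R / 2); first by rewrite !divr_gt0.
move=> w' w'w; apply: eU; first exact: step_fun_Lp.
apply: (@le_lt_trans _ _ (#|C|%:R * (e / #|C|.+1%:R / 2))%:E).
  apply: Lnorm_le_bound => //.
    by apply: (measurable_norm_diff sepY); exact: measurable_step_fun.
  move=> x; rewrite normr_id; apply: step_fun_le => c.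
  by rewrite distrC ltW.
rewrite lte_fin.
have h : #|C|%:R * (e / #|C|.+1%:R) <= e.
  by rewrite mulrCA ger_pMr// ler_pdivrMr// mul1r ler_nat.
have -> : #|C|%:R * (e / #|C|.+1%:R / 2) = #|C|%:R * (e / #|C|.+1%:R) / 2 :> R.
  by rewrite mulrA.
apply: (@le_lt_trans _ _ (e / 2)); last lra.
by rewrite ler_pM2r// invr_gt0.
Qed.

End step_functions.

Section averaging_estimator.
Context {R : realType} {X Y : hilbertType R} (mu : probability (borel X) R) (p : R).
Hypothesis p1 : 1 <= p.
Hypothesis sepY : separable_space Y.
Variables (gamma : probability (borel Y) R) (sigma B L : R).
Hypothesis B0 : 0 <= B.
Hypothesis L0 : 0 <= L.
Hypothesis gamma0 : forall h : Y, (\int[gamma]_e (inner e h)%:E = 0)%E.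
Hypothesis gamma2 : (\int[gamma]_e (`|e : Y| ^+ 2)%:E <= 1%:E)%E.
Variables (C : finType) (z : C -> X) (A : C -> set X).
Hypothesis C0 : (0 < #|C|)%N.
Hypothesis zinj : injective z.
Hypothesis mA : forall c, measurable (A c : set (borel X)).
Hypothesis tA : forall c c' x, A c x -> A c' x -> c = c'.
Variables (delta T beta : R) (t : X -> R).
Hypothesis t0 : forall x, 0 <= t x.
Hypothesis mt : measurable_fun [set: borel X] (t : borel X -> R).
Hypothesis T0 : 0 <= T.
Hypothesis delta0 : 0 <= delta.
Hypothesis beta0 : 0 <= beta.
Hypothesis cell_radius : forall c x, A c x -> `|x - z c| <= delta + t x.
Hypothesis t_moment : (\int[mu]_x (t x `^ p)%:E <= (T `^ p)%:E)%E.
Let out : set (borel X) := ~` (\bigcup_(c in [set: C]) A c).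
Hypothesis out_small : (mu out <= (beta `^ p)%:E)%E.
Variable m : nat.
Hypothesis m0 : (0 < m)%N.

Local Notation data := (m.-tuple (borel X * borel Y)%type).
Let w : R := #|C|%:R / m%:R.

(** The normalisation by the expected number of design points in a cell, rather
    than by the actual number, keeps the estimator linear in the observed values. *)
Definition cell_value (c : C) (D : data) : Y :=
  \sum_(j < m) (if (tnth D j).1 == z c then w *: ((tnth D j).2 : Y) else 0).

Definition averaging (D : data) : X -> Y := step_fun A (fun c => cell_value c D).

Lemma measurable_cell_value c :
  measurable_fun [set: data] (cell_value c : data -> borel Y).
Proof.
apply: (measurable_hsum sepY) => j.
have mj := @measurable_tnth _ (borel X * borel Y)%type m j.
apply: measurable_fun_ifT => //=.
- have mz : measurable_fun [set: borel X] (fun x : borel X => (x : X) == z c).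
    apply: (@measurable_fun_bool _ _ _ _ true).
    rewrite setTI (_ : _ @^-1` _ = [set z c]); last first.
      by apply/seteqP; split => x /=; [move/eqP|move=> ->; rewrite eqxx].
    exact: measurable_set1_borel.
  apply: (measurableT_comp mz).
  by apply: (measurableT_comp _ mj); exact: measurable_fst.
- apply: measurable_hscale.
  by apply: (measurableT_comp _ mj); exact: measurable_snd.
Qed.

Lemma averaging_estimator : estimator mu p data averaging.
Proof. by apply: step_estimator => // c; exact: measurable_cell_value. Qed.

Definition cell_error (F : X -> Y) (D : data) : R :=
  \sum_c `|cell_value c D - F (z c)| ^+ 2.

Lemma cell_error_ge0 F D : 0 <= cell_error F D.
Proof. by rewrite sumr_ge0// => c _; rewrite sqr_ge0. Qed.

Lemma measurable_cell_error F :
  measurable_fun [set: data] (fun D => (cell_error F D)%:E).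
Proof.
apply/measurable_EFinP; apply: measurable_sum => c; apply/measurable_EFinP.
apply: measurable_norm2; apply: (measurable_hadd sepY) => //.
exact: measurable_cell_value.
Qed.

(** A point of a cell is compared with the centre of that cell. The error at the
    centre, of which only the sum of squares over all cells will be controlled in
    mean, enters linearly through [r <= eps + eps^-1 * r ^+ 2]. *)
Lemma averaging_loss F (D : data) (eps : R) : 0 < eps -> FBL B L F ->
  (Lp_dist mu p F (averaging D) <=
   (L * T + L * delta + B * beta + eps + eps^-1 * cell_error F D)%:E)%E.
Proof.
move=> eps0 [FB FL]; have FF : FBL B L F by split.
have mF := FBL_measurable FF.
have p0 : 0 < p by exact: lt_le_trans p1.
set K := L * delta + eps + eps^-1 * cell_error F D.
have K0 : 0 <= K.
  by rewrite !addr_ge0 ?mulr_ge0 ?cell_error_ge0// ?invr_ge0 ltW.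
have mout : measurable out.
  by apply: measurableC; apply: fin_bigcup_measurable => //; exact: finite_finset.
pose f1 (x : borel X) := L * t x.
pose f2 (x : borel X) := K.
pose f3 (x : borel X) := B * \1_out x.
have mf1 : measurable_fun [set: borel X] f1 by exact: measurable_funM.
have mf3 : measurable_fun [set: borel X] f3 by exact: measurable_funM.
have mf23 : measurable_fun [set: borel X] (f2 \+ f3).
  by apply: measurable_funD => //; exact: measurable_cst.
have pw x : `|F x - averaging D x| <= f1 x + (f2 x + f3 x).
  rewrite /f1 /f2 /f3 /averaging /step_fun.
  have [[c _ Acx]|nAx] := pselect ((\bigcup_(c in [set: C]) A c) x).
    have -> : \1_out x = 0 :> R.
      by rewrite indicE memNset//=; apply; exists c.
    rewrite mulr0 addr0 (bigD1 c)//= big1 ?addr0; last first.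
      move=> c' c'c; rewrite indicE memNset ?scale0r// => Ac'x.
      by move/eqP: c'c; apply; exact: tA Ac'x Acx.
    rewrite indicE mem_set// scale1r.
    rewrite -(subrKA (F (z c))) (le_trans (ler_normD _ _))//.
    have h1 : `|F x - F (z c)| <= L * (delta + t x).
      by rewrite (le_trans (FL _ _))// ler_wpM2l// cell_radius.
    have h2 : `|F (z c) - cell_value c D| <= eps + eps^-1 * cell_error F D.
      rewrite distrC; set u := `|_|.
      have u2 : u ^+ 2 <= cell_error F D.
        by rewrite /cell_error (bigD1 c)//= lerDl sumr_ge0// => i _; rewrite sqr_ge0.
      apply: (@le_trans _ _ (eps + eps^-1 * u ^+ 2)); last first.
        by rewrite lerD2l ler_wpM2l// invr_ge0 ltW.
      rewrite -(ler_pM2l eps0) mulrDr mulrA mulfV ?gt_eqF// mul1r.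
      have := sqr_ge0 (eps - u); have := mulr_ge0 (ltW eps0) (normr_ge0 (cell_value c D - F (z c))).
      rewrite -/u sqrrB -!expr2; lra.
    rewrite /K; lra.
  have -> : \1_out x = 1 :> R by rewrite indicE mem_set.
  rewrite big1 ?subr0 ?mulr1; last first.
    by move=> c _; rewrite indicE memNset ?scale0r// => Acx; apply: nAx; exists c.
  have := FB x; have := mulr_ge0 L0 (t0 x); lra.
apply: (@le_trans _ _ ('N[mu]_p%:E[EFin \o (f1 \+ (f2 \+ f3))%R])%E).
  apply: Lnorm_le_mono => //.
  - apply: (measurable_norm_diff sepY) => //; exact: (averaging_estimator.1 D).1.
  - exact: measurable_funD.
  - by move=> x; rewrite normr_id (le_trans (pw x))//= ler_norm.
apply: (le_trans (minkowski_EFin mu mf1 mf23 p1)).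
apply: (@le_trans _ _ ((L * T)%:E + (K%:E + (B * beta)%:E))%E); last first.
  by rewrite -!EFinD lee_fin /K; lra.
apply: leeD.
  apply: Lnorm_le_of_integral => //; first exact: mulr_ge0.
  have -> : (fun x => (`|f1 x| `^ p)%:E) = (fun x => ((L `^ p)%:E * (t x `^ p)%:E)%E).
    by apply/funext => x; rewrite -EFinM -powRM// ger0_norm// mulr_ge0.
  rewrite ge0_integralZl//; last 3 first.
  - by apply/measurable_EFinP; exact: (measurableT_comp (measurable_powR p) mt).
  - by move=> x _; rewrite lee_fin powR_ge0.
  - by rewrite lee_fin powR_ge0.
  by rewrite powRM// EFinM lee_wpmul2l// lee_fin powR_ge0.
have mf2 : measurable_fun [set: borel X] f2 by exact: measurable_cst.
apply: (le_trans (minkowski_EFin mu mf2 mf3 p1)).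
apply: leeD.
  by apply: Lnorm_le_bound => // x; rewrite ger0_norm.
apply: Lnorm_le_of_integral => //; first exact: mulr_ge0.
have -> : (fun x => (`|f3 x| `^ p)%:E) = (fun x => ((B `^ p)%:E * (\1_out x)%:E)%E).
  apply/funext => x; rewrite -EFinM /f3 ger0_norm ?mulr_ge0// powRM//; congr (_ * _)%:E.
  by rewrite indicE; case: (x \in out); rewrite ?powR1// powR0// gt_eqF.
rewrite ge0_integralZl//; last 2 first.
- by apply/measurable_EFinP; exact: measurable_indic.
- by rewrite lee_fin powR_ge0.
by rewrite integral_indic// setIT powRM// EFinM lee_wpmul2l// lee_fin powR_ge0.
Qed.

Let hits (x : m.-tuple (borel X)) (c : C) : R := \sum_(j < m) (tnth x j == z c)%:R.

Definition imbalance (x : m.-tuple (borel X)) : R :=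
  \sum_c (w * hits x c - 1) ^+ 2.

Let sum_hits x : \sum_c hits x c <= m%:R.
Proof.
rewrite exchange_big/= -[leRHS]mulr1 mulr_natl -[in leRHS](card_ord m) -sumr_const.
apply: ler_sum => j _.
have [[c Ec]|H] := pselect (exists c, tnth x j == z c).
  rewrite (bigD1 c)//= Ec big1 ?addr0// => c' c'c.
  rewrite (eqP Ec); case: eqP => // /zinj /eqP; rewrite eq_sym (negbTE c'c)//.
rewrite big1// => c _; case E : (tnth x j == z c) => //.
by case: H; exists c.
Qed.

(** The bias of a cell value comes from the imbalance of the design only, and its
    variance is that of a weighted sum of independent noise vectors. *)
Lemma cell_error_integral F (x : m.-tuple (borel X)) : FBL B L F ->
  (\int[iid gamma m]_e (cell_error F (observe sigma F x e))%:E <=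
   (B ^+ 2 * imbalance x + w ^+ 2 * sigma ^+ 2 * m%:R)%:E)%E.
Proof.
move=> [FB FL]; have FF : FBL B L F by split.
pose a c (j : 'I_m) : R := (w * sigma) * (tnth x j == z c)%:R.
pose v c := (w * hits x c - 1) *: F (z c).
have E c e : cell_value c (observe sigma F x e) - F (z c) =
    v c + \sum_(j < m) a c j *: (tnth e j : Y).
  rewrite /cell_value /v scalerBl scale1r -addrA [- F _ + _]addrC addrA; congr (_ - _).
  rewrite mulr_sumr scaler_suml -big_split /=; apply: eq_bigr => j _.
  rewrite tnth_mktuple /= /a; case: eqP => [->|_]; last by rewrite !mulr0 !scale0r addr0.
  by rewrite !mulr1 scalerDr scalerA.
have mid : measurable_fun [set: borel Y] (id : borel Y -> borel Y) by exact: measurable_id.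
have mom c := iid_second_moment sepY mid gamma0 gamma2 (a c) (v c).
rewrite /cell_error; under eq_integral do rewrite -sumEFin.
rewrite ge0_integral_sum//; last first.
  move=> c; apply: measurable_norm2; apply: (measurable_hadd sepY) => //.
  apply: (measurableT_comp (measurable_cell_value c)).
  apply: (measurable_observe sepY) => //; exact: FBL_measurable FF.
apply: (@le_trans _ _ (\sum_c (`|v c| ^+ 2 + (\sum_(j < m) a c j ^+ 2) * 1)%:E)%E).
  apply: lee_sum => c _; under eq_integral do rewrite E.
  exact: mom.
rewrite sumEFin lee_fin big_split/=; apply: lerD.
  rewrite /imbalance mulr_sumr; apply: ler_sum => c _.
  rewrite /v normrZ exprMn real_normK ?num_real// mulrC ler_wpM2r ?sqr_ge0//.
  by rewrite ler_pXn2r ?nnegrE.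
have -> : \sum_c (\sum_(j < m) a c j ^+ 2) * 1 = w ^+ 2 * sigma ^+ 2 * \sum_c hits x c.
  rewrite mulr_sumr; apply: eq_bigr => c _; rewrite mulr1 /hits mulr_sumr.
  apply: eq_bigr => j _; rewrite /a !exprMn; congr (_ * _).
  by case: eqP; rewrite ?expr1n ?expr0n.
by rewrite ler_wpM2l// mulr_ge0 ?sqr_ge0.
Qed.

Section random_centers.
Variable nu : probability (borel X) R.
Hypothesis nuz : forall c, nu [set z c] = (#|C|%:R^-1)%:E.
Variable u : Y.
Hypothesis u1 : `|u| = 1.

Let G0 : 0 < #|C|%:R :> R. Proof. by rewrite ltr0n. Qed.
Let w0 : 0 <= w. Proof. by rewrite divr_ge0. Qed.

Lemma measurable_imbalance :
  measurable_fun [set: m.-tuple (borel X)] (fun x => (imbalance x)%:E).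
Proof.
apply/measurable_EFinP; apply: measurable_sum => c.
apply: measurable_funX; apply: measurable_funB => //; apply: measurable_funM => //.
apply: measurable_sum => j.
have mz : measurable_fun [set: borel X] (\1_[set z c] : borel X -> R).
  by apply: measurable_indic; exact: measurable_set1_borel.
rewrite (_ : (fun x => _) = (\1_[set z c] : borel X -> R) \o (fun x => tnth x j)).
  exact: (measurableT_comp mz (measurable_tnth j)).
apply/funext => x /=; rewrite indicE; congr (_ %:R); congr nat_of_bool.
by apply/eqP/idP => [/mem_set//|/set_mem].
Qed.

(** The number of design points in a cell is binomial with mean [m / #|C|]; only
    its variance matters. It is obtained from the vector-valued moment bound
    applied to multiples of a unit vector. *)
Lemma imbalance_integral :
  (\int[iid nu m]_x (imbalance x)%:E <= (#|C|%:R ^+ 2 / m%:R)%:E)%E.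
Proof.
pose g c (x : borel X) : Y := ((\1_[set z c] x : R) - #|C|%:R^-1) *: u.
have mz c : measurable ([set z c] : set (borel X)) by exact: measurable_set1_borel.
have mi c : measurable_fun [set: borel X] (\1_[set z c] : borel X -> R).
  exact: measurable_indic.
have mg c : measurable_fun [set: borel X] (g c : borel X -> borel Y).
  by apply: (measurableT_comp (measurable_hscalel u)); apply: measurable_funB.
have ig c : nu.-integrable setT (fun x => (\1_[set z c] x : R)%:E).
  by apply: integrable_indic => //; rewrite ?nuz ?ltry.
have ic (r : R) : nu.-integrable setT (EFin \o cst r).
  exact: finite_measure_integrable_cst.
have iE c : (\int[nu]_x (\1_[set z c] x : R)%:E = (#|C|%:R^-1)%:E)%E.
  by rewrite integral_indic// setIT; exact: nuz.
have g0 c h : (\int[nu]_x (inner (g c x) h)%:E = 0)%E.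
  under eq_integral do rewrite /g innerZl mulrC EFinM EFinB.
  rewrite integralZl//; last exact: (integrableB _ (ig c) (ic _)).
  rewrite integralB//; last exact: (ic (#|C|%:R^-1)).
  by rewrite iE integral_probability_cst -EFinB subrr mule0.
have g2 c : (\int[nu]_x (`|g c x| ^+ 2)%:E <= (#|C|%:R^-1)%:E)%E.
  have -> : (fun x => (`|g c x| ^+ 2)%:E) = (fun x =>
     (((1 - 2 * #|C|%:R^-1))%:E * (\1_[set z c] x : R)%:E + (#|C|%:R^-1 ^+ 2)%:E)%E).
    apply/funext => x; rewrite /g normrZ u1 mulr1 real_normK ?num_real//.
    rewrite -EFinM -EFinD; congr EFin; rewrite indicE.
    by case: (x \in [set z c]) => /=; ring.
  rewrite integralD//; last 2 first.
  - exact: integrableZl.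
  - exact: (ic (#|C|%:R^-1 ^+ 2)).
  rewrite integralZl// iE integral_probability_cst -EFinM -EFinD lee_fin.
  have := sqr_ge0 (#|C|%:R^-1 : R); rewrite expr2; lra.
have mom c := iid_second_moment sepY (mg c) (g0 c) (g2 c) (fun _ : 'I_m => w) 0.
have E c (x : m.-tuple (borel X)) :
    (w * hits x c - 1) ^+ 2 = `|0 + \sum_(j < m) w *: g c (tnth x j)| ^+ 2.
  have -> : \sum_(j < m) w *: g c (tnth x j) =
      (w * \sum_(j < m) ((\1_[set z c] (tnth x j) : R) - #|C|%:R^-1)) *: u.
    by rewrite mulr_sumr scaler_suml; apply: eq_bigr => j _; rewrite /g scalerA.
  rewrite add0r normrZ u1 mulr1 real_normK ?num_real//.
  congr (_ ^+ 2); rewrite sumrB mulrBr; congr (_ - _).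
    congr (_ * _); apply: eq_bigr => j _; rewrite indicE; congr (_ %:R); congr nat_of_bool.
    by apply/eqP/idP => [/mem_set//|/set_mem].
  rewrite sumr_const card_ord -[_ *+ _]mulr_natr /w mulrACA mulfV ?gt_eqF// mul1r.
  by rewrite mulVf// pnatr_eq0 -lt0n.
rewrite /imbalance; under eq_integral do rewrite -sumEFin.
rewrite ge0_integral_sum//; last 2 first.
- move=> c; under eq_fun do rewrite E.
  apply: measurable_norm2; apply: (measurable_hadd sepY) => //.
  apply: (measurable_hsum sepY) => j; apply: measurable_hscale.
  exact: (measurableT_comp (mg c) (measurable_tnth j)).
- by move=> c x _; rewrite lee_fin sqr_ge0.
apply: (@le_trans _ _ (\sum_(c : C) (#|C|%:R / m%:R)%:E)%E).
  apply: lee_sum => c _; under eq_integral do rewrite E.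
  apply: (le_trans (mom c)); rewrite lee_fin normr0 expr0n add0r sumr_const card_ord.
  rewrite le_eqVlt; apply/orP; left; apply/eqP.
  rewrite -[_ *+ _]mulr_natr /w; field.
  by rewrite pnatr_eq0 -lt0n m0 pnatr_eq0 -lt0n C0.
rewrite sumEFin lee_fin sumr_const -[_ *+ _]mulr_natr.
by rewrite expr2 mulrAC.
Qed.

Lemma balanced_design : exists x : m.-tuple (borel X),
  imbalance x <= 2 * (#|C|%:R ^+ 2 / m%:R).
Proof.
set q := #|C|%:R ^+ 2 / m%:R.
have q0 : 0 < q by rewrite divr_gt0 ?exprn_gt0// ltr0n.
apply: contrapT => /forallNP H.
have : ((2 * q)%:E <= q%:E)%E.
  apply: le_trans imbalance_integral.
  rewrite -(integral_probability_cst (iid nu m)); apply: ge0_le_integral => //.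
  - by move=> x _; rewrite lee_fin ltW// mulr_gt0.
  - exact: measurable_imbalance.
  - by move=> x _; rewrite lee_fin ltW// ltNge; exact/negP.
rewrite lee_fin; lra.
Qed.

Lemma averaging_risk (k : design_kind) (eps : R) : 0 < eps ->
  (minimax_risk mu p gamma sigma (FBL B L) m k <=
   (L * T + L * delta + B * beta + eps +
    eps^-1 * (#|C|%:R ^+ 2 * (2 * B ^+ 2 + sigma ^+ 2) / m%:R))%:E)%E.
Proof.
move=> eps0.
set K := L * T + L * delta + B * beta + eps.
have K0 : 0 <= K.
  by rewrite !addr_ge0 ?mulr_ge0// ltW.
have e0 : 0 <= eps^-1 by rewrite invr_ge0 ltW.
have wE : w ^+ 2 * sigma ^+ 2 * m%:R = #|C|%:R ^+ 2 * sigma ^+ 2 / m%:R.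
  by rewrite /w; field; rewrite pnatr_eq0 -lt0n.
(* integrating the loss bound over an arbitrary law of the sample *)
have loss_int d (D : measurableType d) (Q : probability D R) F
    (x : D -> m.-tuple (borel X)) (e : D -> m.-tuple (borel Y)) (q : R) :
    FBL B L F -> measurable_fun [set: D] x -> measurable_fun [set: D] e ->
    (\int[Q]_s (cell_error F (observe sigma F (x s) (e s)))%:E <= q%:E)%E ->
    (\int[Q]_s Lp_dist mu p F (averaging (observe sigma F (x s) (e s))) <=
      (K + eps^-1 * q)%:E)%E.
  move=> FF mx me hq.
  have mF := FBL_measurable FF.
  have mo := measurable_observe sepY sigma mF mx me.
  have FLp : Lp mu p F by apply: (bounded_Lp mu p1 mF FF.1).
  have mce := measurableT_comp (measurable_cell_error F) mo.
  apply: (@le_trans _ _ (\int[Q]_s (K%:E +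
      eps^-1%:E * (cell_error F (observe sigma F (x s) (e s)))%:E))%E).
    apply: ge0_le_integral => //.
    - by move=> s _; exact: Lnorm_ge0.
    - exact: (measurableT_comp (measurable_loss p1 sepY averaging_estimator FLp) mo).
    - by apply: emeasurable_funD => //; apply: emeasurable_funM.
    - by move=> s _; exact: averaging_loss.
  rewrite ge0_integralD//; last 2 first.
  - by move=> s _; rewrite -EFinM lee_fin mulr_ge0// cell_error_ge0.
  - by apply: emeasurable_funM.
  rewrite integral_probability_cst ge0_integralZl//; last first.
    by move=> s _; rewrite lee_fin cell_error_ge0.
  by rewrite [leRHS]EFinD; apply: leeD => //; rewrite EFinM lee_wpmul2l.
case: k.
- have [x xbal] := balanced_design.
  apply: ereal_inf_le; eexists; first by exists x.
  apply: ereal_inf_le; eexists; first by exists averaging; [exact: averaging_estimator|].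
  apply: ub_ereal_sup => _ [F FF <-].
  apply: (le_trans (loss_int _ _ (iid gamma m) F (fun=> x) id _ FF _ _ (cell_error_integral x FF))) => //.
  rewrite lee_fin lerD2l ler_wpM2l// wE.
  have -> : #|C|%:R ^+ 2 * (2 * B ^+ 2 + sigma ^+ 2) / m%:R =
    B ^+ 2 * (2 * (#|C|%:R ^+ 2 / m%:R)) + #|C|%:R ^+ 2 * sigma ^+ 2 / m%:R by ring.
  by rewrite lerD2r ler_wpM2l// sqr_ge0.
- apply: ereal_inf_le; eexists; first by exists nu.
  apply: ereal_inf_le; eexists; first by exists averaging; [exact: averaging_estimator|].
  apply: ub_ereal_sup => _ [F FF <-].
  have mF := FBL_measurable FF.
  apply: (@le_trans _ _ (K + eps^-1 * (B ^+ 2 * (#|C|%:R ^+ 2 / m%:R) + w ^+ 2 * sigma ^+ 2 * m%:R))%:E).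
    apply: (loss_int _ _ _ F fst snd) => //.
    have mo := measurable_observe sepY sigma mF (@measurable_fst _ _ (m.-tuple (borel X)) (m.-tuple (borel Y))) measurable_snd.
    have mce := measurableT_comp (measurable_cell_error F) mo.
    rewrite fubini_tonelli1//; last by move=> s; rewrite lee_fin cell_error_ge0.
    rewrite /fubini_F /=.
    apply: (@le_trans _ _ (\int[iid nu m]_x ((B ^+ 2)%:E * (imbalance x)%:E +
        (w ^+ 2 * sigma ^+ 2 * m%:R)%:E))%E).
      apply: ge0_le_integral => //.
      - by move=> x _; apply: integral_ge0 => e _; rewrite lee_fin cell_error_ge0.
      - apply: (measurable_fun_fubini_tonelli_F (m2 := iid gamma m) _ mce) => s.
        by rewrite lee_fin cell_error_ge0.
      - by apply: emeasurable_funD => //; apply: emeasurable_funM => //; exact: measurable_imbalance.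
      - by move=> x _; rewrite -EFinM -EFinD; exact: cell_error_integral.
    have im0 x : 0 <= imbalance x by rewrite sumr_ge0// => c _; rewrite sqr_ge0.
    rewrite ge0_integralD//; last 3 first.
    - by move=> x _; rewrite -EFinM lee_fin mulr_ge0 ?sqr_ge0.
    - by apply: emeasurable_funM => //; exact: measurable_imbalance.
    - by move=> x _; rewrite lee_fin mulr_ge0// mulr_ge0 ?sqr_ge0.
    rewrite integral_probability_cst ge0_integralZl//; last 3 first.
    - exact: measurable_imbalance.
    - by move=> x _; rewrite lee_fin.
    - by rewrite lee_fin sqr_ge0.
    rewrite [leRHS]EFinD; apply: leeD => //.
    by apply: (lee_wpmul2l _ imbalance_integral); rewrite lee_fin sqr_ge0.
  rewrite lee_fin lerD2l ler_wpM2l// wE.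
  have : 0 <= B ^+ 2 * (#|C|%:R ^+ 2 / m%:R) by rewrite mulr_ge0 ?sqr_ge0// divr_ge0 ?sqr_ge0.
  have -> : #|C|%:R ^+ 2 * (2 * B ^+ 2 + sigma ^+ 2) / m%:R =
    2 * (B ^+ 2 * (#|C|%:R ^+ 2 / m%:R)) + #|C|%:R ^+ 2 * sigma ^+ 2 / m%:R by ring.
  lra.
Qed.

End random_centers.
End averaging_estimator.

(** * Upper bound on the minimax risk in terms of the dimension *)

Section noise.
Context {R : realType} {Y : hilbertType R}.
Variables (gamma : probability (borel Y) R) (Upsilon : Y -> Y).
Hypothesis noise : gaussian_noise gamma Upsilon.

Lemma noise_second_moment : (\int[gamma]_e (`|e : Y| ^+ 2)%:E <= 1%:E)%E.
Proof.
have [_ _ covU [D [e [eb etr]]]] := noise.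
pose f i (x : borel Y) := if i \in D then (inner (x : Y) (e i) ^+ 2)%:E else 0%E.
have f0 i x : (0 <= f i x)%E by rewrite /f; case: ifP => // _; rewrite lee_fin sqr_ge0.
have mf i : measurable_fun [set: borel Y] (f i).
  rewrite /f; case: (i \in D); last exact: measurable_cst.
  by apply/measurable_EFinP; apply: measurable_funX; exact: measurable_inner.
apply: (@le_trans _ _ (\int[gamma]_x \sum_(0 <= i <oo) f i x)%E).
  apply: ge0_le_integral => //.
  - by apply: measurable_norm2; exact: measurable_id.
  - by apply: ge0_emeasurable_sum.
  - by move=> x _; rewrite /f -eseries_mkcond; exact: parseval_le.
rewrite integral_nneseries// -etr esum_mkcond nneseries_esumT; last first.
  by move=> i; exact: integral_ge0.
apply: le_esum => i _; rewrite /f; case: ifP => _; last by rewrite integral0.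
by under eq_integral do rewrite expr2; rewrite covU.
Qed.

Lemma noise_unit_vector : exists u : Y, `|u| = 1.
Proof.
have [_ _ _ [D [e [eb etr]]]] := noise.
have [i Di] : D !=set0.
  apply/set0P/eqP => D0; move: etr; rewrite D0 esum_set0 => /eqP.
  by rewrite eqe eq_sym oner_eq0.
by exists (e i); exact: (orthonormal_norm1 eb).
Qed.

End noise.

Lemma uniform_on_centers {R : realType} {X : hilbertType R} (C : finType)
    (z : C -> X) : (0 < #|C|)%N -> injective z ->
  exists nu : probability (borel X) R, forall c, nu [set z c] = (#|C|%:R^-1)%:E.
Proof.
move=> C0 zinj; have c0 : C by exact: (enum_val (Ordinal C0)).
pose center (i : nat) : borel X := z (nth c0 (enum C) i).
pose s : {measure set (borel X) -> \bar R} :=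
  msum (fun i => \d_(center i) : {measure set (borel X) -> \bar R}) #|C|.
exists (mnormalize s (\d_(z c0 : borel X) : probability (borel X) R)) => c.
have sT : s setT = (#|C|%:R)%:E.
  rewrite /s /= /msum (eq_bigr (fun=> 1%:E)); last by move=> i _; rewrite /= diracE in_setT.
  by rewrite sumEFin sumr_const card_ord.
have sc : s [set z c] = 1%E.
  rewrite /s /= /msum (bigD1 (enum_rank c))//= big1 ?adde0.
    by rewrite /center diracE nth_enum_rank mem_set.
  move=> i ic; rewrite diracE memNset//= /center => /zinj E.
  move/eqP: ic; apply; rewrite -E.
  rewrite -[i in LHS]enum_valK; congr enum_rank.
  by rewrite (enum_val_nth c0).
have nuE (A : set (borel X)) : mnormalize s (\d_(z c0 : borel X)) A =
    (s A * ((fine (s setT))^-1)%:E)%E.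
  rewrite /mnormalize ifF// sT.
  by rewrite eqe pnatr_eq0 -leqn0 leqNgt C0.
apply: etrans (nuE _) _.
by rewrite sT [X in (X * _)%E](sc : s [set z c] = 1%E) mul1e.
Qed.

Section quantization.
Context {R : realType} {X : hilbertType R}.
Variables (phi : nat -> X) (d K : nat) (eta : R).
Hypothesis phi_basis : orthonormal_basis setT phi.
Hypothesis eta0 : 0 < eta.

Definition grid_point (k : nat) : R := eta * (k%:R - K%:R).

Definition cube_center (c : {ffun 'I_d -> 'I_(K + K)}) : X :=
  \sum_(i < d) grid_point (c i) *: phi i.

Definition cube (c : {ffun 'I_d -> 'I_(K + K)}) : set X :=
  [set x | forall i, grid_point (c i) <= inner x (phi i) < grid_point (c i) + eta].

Lemma grid_pointD k : grid_point k + eta = eta * (k%:R - K%:R + 1).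
Proof. by rewrite mulrDr mulr1. Qed.

Lemma cube_center_inj : injective cube_center.
Proof.
have ip c (i : 'I_d) : inner (cube_center c) (phi i) = grid_point (c i).
  rewrite inner_suml (bigD1 i)//= innerZl (phi_basis.1)// eqxx mulr1 big1 ?addr0//.
  move=> j ji; rewrite innerZl (phi_basis.1)//.
  by rewrite (negbTE (ji : (j != i :> nat))) mulr0.
move=> c c' cc'; apply/ffunP => i; apply: val_inj => /=.
have := ip c i; rewrite cc' ip /grid_point => /(mulfI (negbT (gt_eqF eta0))).
by move/addIr/eqP; rewrite eqr_nat => /eqP.
Qed.

Lemma cube_disjoint c c' x : cube c x -> cube c' x -> c = c'.
Proof.
move=> cx c'x; apply/ffunP => i; apply: val_inj => /=.
have key (k l : nat) y : grid_point k <= y -> y < grid_point l + eta -> (k <= l)%N.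
  move=> ky yl; rewrite -ltnS -(ltr_nat R) -natr1.
  have : grid_point k < grid_point l + eta by exact: le_lt_trans yl.
  rewrite grid_pointD /grid_point ltr_pM2l//; lra.
have /andP[h1 h2] := cx i; have /andP[h3 h4] := c'x i.
by apply/eqP; rewrite eqn_leq (key _ _ _ h1 h4) (key _ _ _ h3 h2).
Qed.

Lemma measurable_cube c : measurable (cube c : set (borel X)).
Proof.
have -> : (cube c : set (borel X)) = \bigcap_(i in [set: 'I_d])
    ((fun x : borel X => inner (x : X) (phi i)) @^-1`
      `[grid_point (c i), grid_point (c i) + eta[%classic).
  apply/seteqP; split => x cx i; first by move=> _ /=; rewrite in_itv /=; exact: cx.
  by have := cx i Logic.I; rewrite /= in_itv.
apply: fin_bigcap_measurable; first exact: finite_finset.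
move=> i _; rewrite -[X in measurable X]setTI.
by apply: measurable_inner => //; exact: measurable_itv.
Qed.

Lemma cube_radius c x : cube c x ->
  `|x - cube_center c| <= d%:R * eta + `|x - proj phi d x|.
Proof.
move=> cx; rewrite -(subrKA (proj phi d x)) addrC (le_trans (ler_normD _ _))//.
rewrite lerD2r /proj /cube_center -sumrB (le_trans (ler_norm_sum _ _ _))//.
rewrite mulr_natl -[in leRHS](card_ord d) -sumr_const; apply: ler_sum => i _.
rewrite -scalerBl normrZ (orthonormal_norm1 phi_basis)// mulr1.
have /andP[h1 h2] := cx i; rewrite ger0_norm ?subr_ge0//; lra.
Qed.

Lemma cube_cover x : (forall c, ~ cube c x) -> eta * K%:R <= `|x|.
Proof.
move=> ncx; rewrite leNgt; apply/negP => xK.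
have xi i : `|inner x (phi i)| < eta * K%:R.
  apply: le_lt_trans xK; apply: (le_trans (inner_le_norm _ _)).
  by rewrite (orthonormal_norm1 phi_basis)// mulr1.
have /choice[k kP] : forall i : 'I_d, exists k : 'I_(K + K),
    grid_point k <= inner x (phi i) < grid_point k + eta.
  move=> i; have := xi i; rewrite ltr_norml => /andP[lo hi].
  pose y := inner x (phi i) / eta + K%:R.
  have y0 : 0 <= y.
    by rewrite /y -lerBlDr sub0r ler_pdivlMr// mulrC mulrN ltW.
  have yt := truncn_itv y0; move/andP : yt => [t1 t2].
  have kK : (Num.truncn y < K + K)%N.
    rewrite -(ltr_nat R) (le_lt_trans t1)// natrD /y ltrD2r ltr_pdivrMr//.
    by rewrite mulrC.
  exists (Ordinal kK); rewrite grid_pointD /grid_point /=.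
  have E : inner x (phi i) = eta * (y - K%:R).
    by rewrite /y addrK mulrC divfK// gt_eqF.
  rewrite E ler_pM2l// ltr_pM2l// lerD2r t1 /=.
  rewrite -natr1 in t2; lra.
by apply: (ncx [ffun i => k i]) => i; rewrite ffunE.
Qed.

Lemma card_cubes : #|{ffun 'I_d -> 'I_(K + K)}| = ((K + K) ^ d)%N.
Proof. by rewrite card_ffun !card_ord. Qed.

End quantization.

Section measure_tails.
Context {R : realType} {X : hilbertType R} (mu : probability (borel X) R).

Lemma norm_tail_le (S r : R) : 0 < r ->
  (\int[mu]_x (`|x : X| ^+ 2)%:E <= S%:E)%E ->
  (mu [set x : borel X | (r <= `|x : X|)%R] <= (S / r ^+ 2)%:E)%E.
Proof.
move=> r0 hS; set A := [set x : borel X | _].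
have mA : measurable A by exact: measurable_norm_ge.
have r20 : 0 < r ^+ 2 by rewrite exprn_gt0.
have h : (\int[mu]_x ((r ^+ 2)%:E * (\1_A x)%:E) <= S%:E)%E.
  apply: le_trans hS; apply: ge0_le_integral => //.
  - by move=> x _; rewrite -EFinM lee_fin mulr_ge0// ltW.
  - by apply: emeasurable_funM => //; apply/measurable_EFinP; exact: measurable_indic.
  - by apply: measurable_norm2; exact: measurable_id.
  - move=> x _; rewrite -EFinM lee_fin indicE; case: (boolP (x \in A)) => [|_].
      by move=> /set_mem; rewrite /A /= mulr1 => rx; rewrite ler_pXn2r ?nnegrE ?(ltW r0).
    by rewrite mulr0 sqr_ge0.
move: h; rewrite ge0_integralZl//; last 2 first.
- by apply/measurable_EFinP; exact: measurable_indic.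
- by rewrite lee_fin ltW.
rewrite integral_indic// setIT => h.
have muA : mu A \is a fin_num by exact: fin_num_measure.
by rewrite -(fineK muA) lee_fin ler_pdivlMr// mulrC -lee_fin EFinM fineK.
Qed.

(** Lower moments are controlled by splitting at the scale [s] of the variable
    itself, which keeps the scaling exact. *)
Lemma moment_interpolation (t : X -> R) (p P A s : R) :
  measurable_fun [set: borel X] (t : borel X -> R) ->
  (forall x, 0 <= t x) -> 1 <= p -> p <= P -> 0 <= A -> 0 < s ->
  (\int[mu]_x (t x `^ P)%:E <= (A * s `^ P)%:E)%E ->
  (\int[mu]_x (t x `^ p)%:E <= (((1 + A) * s) `^ p)%:E)%E.
Proof.
move=> mt t0 p1 pP A0 s0 hP.
have p_ge0 : 0 <= p by rewrite (le_trans _ p1).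
have mpow (r : R) : measurable_fun [set: borel X] (fun x => (t x `^ r)%:E).
  by apply/measurable_EFinP; exact: (measurableT_comp (measurable_powR r) mt).
apply: (@le_trans _ _ (\int[mu]_x ((s `^ p)%:E + (s `^ (p - P))%:E * (t x `^ P)%:E))%E).
  apply: ge0_le_integral => //.
  - by move=> x _; rewrite lee_fin powR_ge0.
  - by apply: emeasurable_funD => //; exact: emeasurable_funM.
  - move=> x _; rewrite -EFinM -EFinD lee_fin.
    have [ts|/ltW st] := leP (t x) s.
      by rewrite ler_wpDr ?mulr_ge0 ?powR_ge0//; exact: powR_le_base.
    rewrite ler_wpDl ?powR_ge0//.
    have tx0 : 0 < t x by exact: lt_le_trans st.
    rewrite -[p in leLHS](subrK P) [leLHS]powRD; last by rewrite (gt_eqF tx0) implybT.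
    rewrite ler_wpM2r ?powR_ge0//.
    rewrite -(opprB P) !powRN lef_pV2 ?posrE ?powR_gt0//.
    by apply: powR_le_base => //; [rewrite subr_ge0|exact: ltW].
rewrite ge0_integralD//; last 3 first.
- by move=> x _; rewrite lee_fin powR_ge0.
- by move=> x _; rewrite -EFinM lee_fin mulr_ge0 ?powR_ge0.
- exact: emeasurable_funM.
rewrite integral_probability_cst ge0_integralZl//; last 2 first.
- by move=> x _; rewrite lee_fin powR_ge0.
- by rewrite lee_fin powR_ge0.
apply: (@le_trans _ _ (s `^ p + s `^ (p - P) * (A * s `^ P))%:E).
  rewrite [leRHS]EFinD; apply: leeD => //.
  by apply: (lee_wpmul2l _ hP); rewrite lee_fin powR_ge0.
have -> : s `^ (p - P) * (A * s `^ P) = A * s `^ p.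
  rewrite mulrCA -powRD ?subrK//.
  by rewrite (gt_eqF s0) implybT.
rewrite lee_fin powRM ?addr_ge0// ?(ltW s0)//.
have -> : s `^ p + A * s `^ p = (1 + A) * s `^ p by rewrite mulrDl mul1r.
rewrite ler_wpM2r ?powR_ge0//.
by apply: le1r_powR => //; rewrite lerDl.
Qed.

End measure_tails.

Section upper_rate.
Context {R : realType}.

Lemma powR_natV_le (d kap : nat) (r : R) : (0 < d)%N -> r <= kap%:R ->
  (d%:R ^+ kap)^-1 <= d%:R `^ (- r).
Proof.
move=> d0 rk; rewrite powRN lef_pV2 ?posrE ?powR_gt0 ?exprn_gt0 ?ltr0n//.
by rewrite -powR_mulrn//; apply: ler_powR => //; rewrite ler1n.
Qed.

(** The cubes have side [d ^- kap.+1] and cover a box of half-width [d ^+ kap], so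
    there are at most [(d ^ (2 * kap + 2)) ^ d] of them. If [m] exceeds the fourth
    power of this number then the statistical error is at most a multiple of the
    inverse of the number of cubes. For [kap] large this error, the diameter of the
    cubes and the mass outside the box are all dominated by the contribution of
    the coordinates beyond [d]. *)
Lemma risk_upper_rate (tau p B L : R) :
  1 < tau -> 1 <= p -> 0 <= B -> 0 <= L ->
  exists kap : nat, exists2 K : R, 0 < K &
  forall (X Y : hilbertType R) (mu : probability (borel X) R)
    (gamma : probability (borel Y) R) (Upsilon : Y -> Y) (iota sigma : R)
    (k : design_kind),
  model mu gamma Upsilon tau iota p B L sigma ->
  \forall d \near \oo, forall m, (((d ^ (2 * kap + 2)) ^ d) ^ 4 <= m)%N ->
    (minimax_risk mu p gamma sigma (FBL B L) m k <=
     (K * d%:R `^ (- ((tau - 1) / 2)))%:E)%E.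
Proof.
move=> tau1 p1 B0 L0.
pose kap := (Num.truncn (p * tau)).+1.
have ptk : p * tau <= kap%:R.
  have := @truncn_itv R (p * tau) (mulr_ge0 (le_trans ler01 p1) (le_trans ler01 (ltW tau1))).
  by move=> /andP[_ /ltW].
have tk : tau <= kap%:R by apply: le_trans ptk; rewrite ler_peMl// (le_trans ler01 (ltW tau1)).
pose P := Num.max p 2.
pose A := 2 `^ (P / 2) * rosenthal_const (P / 2) :> R.
have A0 : 0 <= A.
  by rewrite mulr_ge0 ?powR_ge0// /rosenthal_const addr_ge0// ?mulr_ge0 ?powR_ge0.
pose Ct := (1 + A) * ((tau - 1)^-1 `^ 2^-1).
have Ct0 : 0 <= Ct by rewrite mulr_ge0 ?powR_ge0// addr_ge0.
exists kap; exists (L * Ct + L + B + 1).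
  by rewrite ltr_wpDl// !addr_ge0// mulr_ge0.
move=> X Y mu gamma Upsilon iota sigma k [_ sepY _ _ sigma0 _ _ [phi [a [b [_ cond]]]] noise].
have [_ mz _ _] := noise.
have basis := cond_basis cond.
have [u u1] := noise_unit_vector noise.
have gamma2 := noise_second_moment noise.
have S_fin : (\int[mu]_x (`|x : X| ^+ 2)%:E)%E \is a fin_num.
  rewrite ge0_fin_numE; first exact: (cond_moment2 cond).
  by apply: integral_ge0 => x _; rewrite lee_fin sqr_ge0.
pose S := fine (\int[mu]_x (`|x : X| ^+ 2)%:E)%E.
have tailE := tail_moment tau1 cond.
near=> d.
move=> m Gm.
have d1 : (1 < d)%N by near: d; exact: nbhs_infty_gt.
have d0 : (0 < d)%N by exact: ltnW.
have dR0 : 0 < d%:R :> R by rewrite ltr0n.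
have dR1 : 1 <= d%:R :> R by rewrite ler1n.
have Sd : S <= d%:R by near: d; exact: nbhs_infty_ger.
have Bd : 1 + (2 * B ^+ 2 + sigma ^+ 2) <= d%:R by near: d; exact: nbhs_infty_ger.
have td : (\int[mu]_x (`|(x : X) - proj phi d x| `^ P)%:E <=
    (2 `^ (P / 2) * (rosenthal_const (P / 2) * powR_tail tau d `^ (P / 2)))%:E)%E.
  by near: d.
set rho := d%:R `^ (- ((tau - 1) / 2)).
have rho0 : 0 <= rho by exact: powR_ge0.
pose eta : R := (d%:R ^+ kap.+1)^-1.
have eta0 : 0 < eta by rewrite invr_gt0 exprn_gt0.
pose K := (d ^ (2 * kap).+1)%N.
pose C := {ffun 'I_d -> 'I_(K + K)}.
have cardC : #|C| = ((K + K) ^ d)%N by exact: card_cubes.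
have K0 : (0 < K)%N by rewrite expn_gt0 d0.
have C0 : (0 < #|C|)%N by rewrite cardC expn_gt0 addn_gt0 K0.
have CG : (#|C| <= (d ^ (2 * kap + 2)) ^ d)%N.
  rewrite cardC leq_exp2r// addn2 expnS addnn -mul2n leq_mul2r d1 orbT//.
have C4m : (#|C| ^ 4 <= m)%N by apply: leq_trans Gm; rewrite leq_exp2r.
have m0 : (0 < m)%N by apply: leq_trans C4m; rewrite expn_gt0 C0.
have dkap : (d%:R ^+ kap)^-1 <= rho.
  apply: powR_natV_le => //; apply: le_trans tk; lra.
have dC : d%:R ^+ kap.+1 <= #|C|%:R :> R.
  rewrite -natrX ler_nat cardC (@leq_trans (K ^ 1))//; last first.
    apply: (@leq_trans (K ^ d)%N); first by rewrite leq_pexp2l.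
    by rewrite leq_exp2r ?leq_addr.
  by rewrite expn1 /K leq_pexp2l// ltnS leq_pmull.
have [nu nuz] := @uniform_on_centers R X C (@cube_center _ _ phi d K eta) C0
  (cube_center_inj basis eta0).
have GR0 : 0 < #|C|%:R :> R by rewrite ltr0n.
have delta0 : 0 <= d%:R * eta by rewrite mulr_ge0// ltW.
have T0 : 0 <= Ct * rho by rewrite mulr_ge0.
pose s := powR_tail tau d `^ 2^-1.
have tm0 : 0 < powR_tail tau d by rewrite divr_gt0 ?powR_gt0// subr_gt0.
have s0 : 0 < s by rewrite powR_gt0.
have sE : s = (tau - 1)^-1 `^ 2^-1 * rho.
  rewrite /s /powR_tail powRM ?powR_ge0//; last by rewrite invr_ge0 subr_ge0 ltW.
  by rewrite -powRrM mulrC; congr (_ * _ `^ _); ring.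
have t_moment : (\int[mu]_x (`|(x : X) - proj phi d x| `^ p)%:E <= ((Ct * rho) `^ p)%:E)%E.
  rewrite /Ct -mulrA -sE.
  apply: (moment_interpolation (P := P)) => //.
  - exact: (measurable_tail basis).
  - by rewrite le_max lexx.
  - apply: (le_trans td); rewrite mulrA lee_fin -/A ler_wpM2l//.
    by rewrite /s -powRrM mulrC.
have out_small : (mu (~` (\bigcup_(c in [set: C]) cube phi eta c)) <= (rho `^ p)%:E)%E.
  have Kb : eta * K%:R = d%:R ^+ kap.
    rewrite /eta /K natrX mulrC.
    have -> : ((2 * kap).+1 = kap + kap.+1)%N by rewrite mul2n -addnn addnS.
    by rewrite exprD mulfK// expf_neq0// gt_eqF.
  have dk0 : 0 < d%:R ^+ kap :> R by rewrite exprn_gt0.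
  have mcubes : measurable (\bigcup_(c in [set: C]) (cube phi eta c : set (borel X))).
    apply: fin_bigcup_measurable; first exact: finite_finset.
    by move=> c _; exact: measurable_cube.
  apply: (@le_trans _ _ (mu [set x : borel X | (d%:R ^+ kap <= `|x : X|)%R])).
    apply: le_measure; rewrite ?inE.
    - exact: measurableC.
    - exact: measurable_norm_ge.
    - move=> x /= nx; rewrite -Kb; apply: (cube_cover basis eta0) => c cx.
      by apply: nx; exists c.
  have hS : (\int[mu]_x (`|x : X| ^+ 2)%:E <= S%:E)%E by rewrite fineK.
  apply: (le_trans (norm_tail_le dk0 hS)); rewrite lee_fin.
  apply: (@le_trans _ _ (d%:R ^+ kap)^-1).
    rewrite ler_pdivrMr ?exprn_gt0// expr2 mulrA mulVf ?gt_eqF// mul1r.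
    by rewrite (le_trans Sd)// ler_eXnr.
  rewrite /rho -powRrM mulNr; apply: powR_natV_le => //.
  apply: le_trans ptk; rewrite mulrC ler_wpM2l// ?(le_trans ler01 p1)//; lra.
have eps0 : 0 < #|C|%:R^-1 :> R by rewrite invr_gt0.
have radius (c : C) x : cube phi eta c x ->
    `|x - cube_center phi eta c| <= d%:R * eta + `|x - proj phi d x|.
  exact: cube_radius.
have := averaging_risk p1 sepY sigma B0 L0 mz gamma2 C0 (cube_center_inj basis eta0)
  (@measurable_cube _ _ phi d K eta) (cube_disjoint eta0) (fun x => normr_ge0 _)
  (measurable_tail basis d) T0 delta0 rho0 radius t_moment out_small
  m0 nuz u1 k eps0.
move/le_trans; apply; rewrite lee_fin invrK.
have h1 : d%:R * eta <= rho.
  by apply: le_trans dkap; rewrite /eta exprS invfM mulrA mulfV ?gt_eqF// mul1r.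
have h2 : #|C|%:R^-1 + #|C|%:R * (#|C|%:R ^+ 2 * (2 * B ^+ 2 + sigma ^+ 2) / m%:R) <= rho.
  apply: (@le_trans _ _ ((1 + (2 * B ^+ 2 + sigma ^+ 2)) / #|C|%:R)).
    set v := 2 * B ^+ 2 + sigma ^+ 2.
    have v0 : 0 <= v by rewrite addr_ge0 ?sqr_ge0// mulr_ge0 ?sqr_ge0.
    rewrite [leRHS]mulrDl mul1r lerD2l ler_pdivlMr//.
    have -> : #|C|%:R * (#|C|%:R ^+ 2 * v / m%:R) * #|C|%:R = v * (#|C| ^ 4)%:R / m%:R :> R.
      by rewrite natrX; ring.
    by rewrite ler_pdivrMr ?ltr0n// ler_wpM2l// ler_nat.
  apply: le_trans dkap; rewrite ler_pdivrMr// ler_pdivlMl ?exprn_gt0//.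
  apply: le_trans dC; rewrite [leRHS]exprSr ler_wpM2l// exprn_ge0//.
have h3 := ler_wpM2l L0 h1.
suff : L * (Ct * rho) + L * (d%:R * eta) + B * rho + #|C|%:R^-1 +
  #|C|%:R * (#|C|%:R ^+ 2 * (2 * B ^+ 2 + sigma ^+ 2) / m%:R) <= (L * Ct + L + B + 1) * rho by [].
rewrite !mulrDl mul1r -mulrA; lra.
Unshelve. all: by end_near. Qed.

End upper_rate.

(** * Lower bound on the minimax risk by bumps on unobserved cells *)

Section bigmax_lipschitz.
Context {R : realType}.

Lemma bigmax_lipschitz (I : Type) (s : seq I) (f g : I -> R) (r : R) : 0 <= r ->
  (forall i, `|f i - g i| <= r) ->
  `|\big[Num.max/0]_(i <- s) f i - \big[Num.max/0]_(i <- s) g i| <= r.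
Proof.
move=> r0 fg; elim/big_ind2 : _ => [|x x' y y'|i _]; last exact: fg.
  by rewrite subrr normr0.
rewrite !ler_norml => /andP[h1 h2] /andP[h3 h4].
apply/andP; rewrite /Num.max; case: ifP => [xy|/negbT]; case: ifP => [xy'|/negbT];
  rewrite -?leNgt => *; split; lra.
Qed.

Lemma bigmin_lipschitz (I : Type) (s : seq I) (f g : I -> R) (r x : R) : 0 <= r ->
  (forall i, `|f i - g i| <= r) ->
  `|\big[Num.min/x]_(i <- s) f i - \big[Num.min/x]_(i <- s) g i| <= r.
Proof.
move=> r0 fg; elim/big_ind2 : _ => [|u u' y y'|i _]; last exact: fg.
  by rewrite subrr normr0.
rewrite !ler_norml => /andP[h1 h2] /andP[h3 h4].
apply/andP; rewrite /Num.min; case: ifP => [xy|/negbT]; case: ifP => [xy'|/negbT];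
  rewrite -?leNgt => *; split; lra.
Qed.

End bigmax_lipschitz.

Section bumps.
Context {R : realType} {X : hilbertType R} (mu : probability (borel X) R).
Variables (p a b : R) (lam : nat -> R) (phi : nat -> X).
Hypothesis cond : measure_conditions mu p lam phi a b.
Variables (d n : nat).
Hypothesis d0 : (0 < d)%N.
Hypothesis n0 : (0 < n)%N.
Let xi := coordinate lam phi.
Let rho : R := a / n%:R.
Local Notation cell := {ffun 'I_d -> 'I_n}.

Let nR0 : 0 < n%:R :> R. Proof. by rewrite ltr0n. Qed.
Let rho0 : 0 < rho. Proof. by rewrite divr_gt0// (cond_a_gt0 cond). Qed.

Definition mesh_point (k : nat) : R := - a + (2 * k%:R + 1) * rho.

(** The tent over a cell is measured in the sup norm of the normalised
    coordinates, which the Hilbert norm dominates up to the smallest standard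
    deviation involved. *)
Definition tent (c : cell) (x : X) : R :=
  Num.max 0 (\big[Num.min/rho]_(i < d) (rho - `|xi i x - mesh_point (c i)|)).

Definition bumps (theta : {set cell}) (x : X) : R :=
  \big[Num.max/0]_c (if c \in theta then tent c x else 0).

Lemma tent_ge0 c x : 0 <= tent c x. Proof. by rewrite le_max lexx. Qed.

Lemma tent_le c x : tent c x <= rho.
Proof. by rewrite ge_max (ltW rho0) bigmin_le_id. Qed.

Lemma bumps_ge0 theta x : 0 <= bumps theta x.
Proof. exact: bigmax_ge_id. Qed.

Lemma bumps_le theta x : bumps theta x <= rho.
Proof.
apply: bigmax_le => [|c _]; first exact: ltW.
by case: ifP => _; [exact: tent_le|exact: ltW].
Qed.

Lemma tent_gt0 c x (i : 'I_d) : 0 < tent c x -> `|xi i x - mesh_point (c i)| < rho.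
Proof.
rewrite lt_max ltxx /= => h; rewrite -subr_gt0 (lt_le_trans h)//.
exact: bigmin_le.
Qed.

Lemma mesh_separated (k l : nat) y :
  `|y - mesh_point k| < rho -> `|y - mesh_point l| < rho -> k = l.
Proof.
have key (i j : nat) : `|y - mesh_point i| < rho -> `|y - mesh_point j| < rho -> (i <= j)%N.
  rewrite !ltr_norml /mesh_point => /andP[h1 h2] /andP[h3 h4].
  rewrite -ltnS -(ltr_nat R) -natr1 -(ltr_pM2r rho0); lra.
by move=> h1 h2; apply/eqP; rewrite eqn_leq !key.
Qed.

Lemma tent_disjoint c c' x : 0 < tent c x -> 0 < tent c' x -> c = c'.
Proof.
move=> tc tc'; apply/ffunP => i; apply: val_inj => /=.
by apply: (@mesh_separated _ _ (xi i x)); exact: tent_gt0.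
Qed.

Lemma coordinate_lipschitz i x x' : (i < d)%N ->
  `|xi i x - xi i x'| <= (Num.sqrt (lam d.-1))^-1 * `|x - x'|.
Proof.
move=> id; have l0 j : 0 < Num.sqrt (lam j) by rewrite sqrtr_gt0 (cond_lambda_gt0 cond).
rewrite /xi /coordinate -mulrBl -innerBl normrM normfV (gtr0_norm (l0 i)) mulrC.
apply: ler_pM; rewrite ?invr_ge0 ?(ltW (l0 _))//.
  rewrite lef_pV2 ?posrE// ler_sqrt.
    by apply: (cond_lambda_nincr cond); rewrite -ltnS prednK.
  exact: ltW (cond_lambda_gt0 cond i).
apply: (le_trans (inner_le_norm _ _)).
by rewrite (orthonormal_norm1 (cond_basis cond))// mulr1.
Qed.

Lemma bumps_lipschitz theta x x' :
  `|bumps theta x - bumps theta x'| <= (Num.sqrt (lam d.-1))^-1 * `|x - x'|.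
Proof.
have r0 : 0 <= (Num.sqrt (lam d.-1))^-1 * `|x - x'|.
  by rewrite mulr_ge0 ?invr_ge0 ?sqrtr_ge0.
apply: bigmax_lipschitz => // c; case: ifP => _; last by rewrite subrr normr0.
have h : `|\big[Num.min/rho]_(i < d) (rho - `|xi i x - mesh_point (c i)|) -
    \big[Num.min/rho]_(i < d) (rho - `|xi i x' - mesh_point (c i)|)| <=
    (Num.sqrt (lam d.-1))^-1 * `|x - x'|.
  apply: bigmin_lipschitz => // i.
  rewrite opprB addrC addrA subrK distrC.
  apply: (le_trans (ler_dist_dist _ _)); rewrite opprB addrA subrK.
  exact: coordinate_lipschitz.
move: h; rewrite /tent /Num.max !ler_norml => /andP[h1 h2].
apply/andP; case: ifP => [xy|/negbT]; case: ifP => [xy'|/negbT];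
  rewrite -?leNgt => *; split; lra.
Qed.

(** The middle half of the cell in each coordinate, where the tent has at least
    half of its height and the other tents vanish. *)
Definition core_slab (c : cell) (i : nat) : set R :=
  if insub i is Some j then
    `[mesh_point (c j) - rho / 2, mesh_point (c j) + rho / 2]%classic
  else setT.

Definition core (c : cell) : set (borel X) :=
  \bigcap_(i in [set` iota 0 d]) (xi i @^-1` core_slab c i).

Lemma core_coordinate c x (i : 'I_d) : core c x ->
  `|xi i x - mesh_point (c i)| <= rho / 2.
Proof.
move=> /(_ i); rewrite /= mem_iota /= ltn_ord => /(_ isT).
rewrite /core_slab (insubT (fun j => j < d)%N (ltn_ord i)) /=.
have -> : Sub (nat_of_ord i) (ltn_ord i) = i by exact: val_inj.
by rewrite in_itv /= => /andP[h1 h2]; rewrite ler_norml; apply/andP; split; lra.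
Qed.

Lemma tent_core c x : core c x -> rho / 2 <= tent c x.
Proof.
move=> cx; rewrite le_max; apply/orP; right.
apply/bigmin_geP; split=> [|i _]; first by have := rho0; lra.
by have := core_coordinate i cx; lra.
Qed.

Lemma bumps_core (theta : {set cell}) c x : core c x ->
  (c \in theta -> rho / 2 <= bumps theta x) /\ (c \notin theta -> bumps theta x = 0).
Proof.
move=> cx; split=> ct.
  apply: (le_trans (tent_core cx)); rewrite /bumps.
  by apply: (bigmax_sup c) => //; rewrite ct.
apply/eqP; rewrite eq_le bumps_ge0 andbT.
apply: bigmax_le => // c' _; case: ifP => // c't.
rewrite leNgt; apply/negP => tc'.
have tc : 0 < tent c x by rewrite (lt_le_trans _ (tent_core cx))// divr_gt0.
by move: ct; rewrite (tent_disjoint tc tc') c't.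
Qed.

Lemma core_disjoint c c' x : core c x -> core c' x -> c = c'.
Proof.
move=> /tent_core h1 /tent_core h2; have r2 : 0 < rho / 2 by rewrite divr_gt0.
by apply: (@tent_disjoint _ _ x); exact: lt_le_trans r2 _.
Qed.

Lemma measurable_core_slab c i : measurable (core_slab c i).
Proof. by rewrite /core_slab; case: insub => [j|]; [exact: measurable_itv|]. Qed.

Lemma measurable_core c : measurable (core c).
Proof.
apply: bigcap_measurableType => i _; rewrite -[X in measurable X]setTI.
apply: (measurable_funM (measurable_inner _) _) => //; exact: measurable_core_slab.
Qed.

Lemma core_slab_measure c i : (i < d)%N ->
  ((b * rho)%:E <= mu (xi i @^-1` core_slab c i))%E.
Proof.
move=> id; have [f [[mf f0 fE] fb]] := cond_density cond i.
rewrite fE; last exact: measurable_core_slab.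
rewrite /core_slab (insubT (fun i => i < d)%N id) /=; set k := c _.
set I := [set` _].
have mI : measurable (I : set R) by exact: measurable_itv.
have b0 : 0 <= b by rewrite ltW// (cond_b_gt0 cond).
apply: (@le_trans _ _ (\int[lebesgue_measure]_(x in I) b%:E)%E).
  have IE : lebesgue_measure I = rho%:E.
    rewrite /I lebesgue_measure_itv /= lte_fin ifT; last by have := rho0; lra.
    by rewrite -EFinD; congr EFin; field.
  by rewrite integral_cst// [X in (_ * X)%E]IE -EFinM.
apply: ge0_le_integral => //.
- by apply/measurable_EFinP; apply: measurable_funTS.
- move=> x; rewrite /I /= in_itv /= lee_fin => /andP[h1 h2]; apply: fb.
  have a_n : n%:R * rho = a by rewrite /rho mulrC divfK// gt_eqF.
  have kn : k.+1%:R * rho <= n%:R * rho by rewrite ler_pM2r// ler_nat.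
  have k0 : 0 <= k%:R * rho by rewrite mulr_ge0// ltW.
  rewrite -natr1 in kn; move: h1 h2; rewrite /mesh_point ler_norml => h1 h2.
  have r0 := rho0; apply/andP; split; lra.
Qed.

Lemma core_measure c : (((b * rho) ^+ d)%:E <= mu (core c))%E.
Proof.
rewrite /core (cond_indep cond) ?iota_uniq//; last first.
  by move=> i _; exact: measurable_core_slab.
have br0 : 0 <= b * rho by rewrite mulr_ge0// ltW// (cond_b_gt0 cond).
suff H s : all (fun i => i < d)%N s ->
    (((b * rho) ^+ size s)%:E <= \prod_(i <- s) mu (xi i @^-1` core_slab c i))%E.
  rewrite -[d in (_ ^+ d)%:E](size_iota 0 d); apply: H.
  by apply/allP => i; rewrite mem_iota.
elim: s => [|i s IH] /=; first by rewrite big_nil.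
move=> /andP[id /IH {}IH]; rewrite big_cons exprS EFinM.
by apply: lee_pmul => //; rewrite ?lee_fin ?exprn_ge0//; exact: core_slab_measure.
Qed.

(** On the core of a cell in [U] one of the two functions is at least half a bump
    high and the other one vanishes; the cores are disjoint, and independence of
    the coordinates bounds the mass of each of them from below. *)
Lemma flip_integral (theta theta' U : {set cell}) (q s : R) : 0 <= s -> 0 <= q ->
  (forall c, c \in U -> (c \in theta') = (c \notin theta)) ->
  ((((s * (rho / 2)) `^ q) * (#|U|%:R * (b * rho) ^+ d))%:E <=
    \int[mu]_x (`|s * (bumps theta x - bumps theta' x)| `^ q)%:E)%E.
Proof.
move=> s0 q0 flip; set K := (s * (rho / 2)) `^ q.
have K0 : 0 <= K by exact: powR_ge0.
have mb (th : {set cell}) : measurable_fun [set: borel X] (bumps th : borel X -> R).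
  by apply: continuous_borel; apply: lipschitz_continuous; exact: bumps_lipschitz.
pose S := \bigcup_(c in [set` enum U]) core c.
have finU : finite_set [set` enum U] by exact: finite_finset.
have mS : measurable S.
  by apply: fin_bigcup_measurable => // c _; exact: measurable_core.
have SP x : S x -> exists2 c, c \in U & core c x.
  by move=> [c]; rewrite /= mem_enum => cU cx; exists c.
have muS : (((#|U|%:R * (b * rho) ^+ d))%:E <= mu S)%E.
  rewrite /S measure_fin_bigcup//; last 2 first.
  - by move=> c c' _ _ [x [/core_disjoint cc' /cc']].
  - by move=> c _; exact: measurable_core.
  rewrite -fsbig_seq ?enum_uniq//.
  apply: (@le_trans _ _ (\sum_(c <- enum U) ((b * rho) ^+ d)%:E)%E); last first.
    by apply: lee_sum => c _; exact: core_measure.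
  by rewrite sumEFin big_enum /= sumr_const mulr_natl.
apply: (@le_trans _ _ (\int[mu]_x (K%:E * (\1_S x)%:E))%E).
  rewrite ge0_integralZl//; last by apply/measurable_EFinP; exact: measurable_indic.
  by rewrite integral_indic// setIT EFinM lee_wpmul2l.
apply: ge0_le_integral => //.
- by move=> x _; rewrite -EFinM lee_fin mulr_ge0.
- by apply: emeasurable_funM => //; apply/measurable_EFinP; exact: measurable_indic.
- apply/measurable_EFinP; apply: (measurableT_comp (measurable_powR q)).
  apply: measurableT_comp => //; apply: measurable_funM => //.
  exact: measurable_funB.
move=> x _; rewrite -EFinM lee_fin indicE; case: (boolP (x \in S)) => [|_]; last first.
  by rewrite mulr0 powR_ge0.
move=> /set_mem /SP[c cU cx]; rewrite mulr1 /K.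
have r20 : 0 <= rho / 2 by rewrite divr_ge0// ltW.
apply: powR_le_base => //; first exact: mulr_ge0.
rewrite normrM ger0_norm// ler_wpM2l//.
have [h1 h2] := bumps_core theta cx; have [h3 h4] := bumps_core theta' cx.
move: h3 h4; rewrite flip//; case: (boolP (c \in theta)) => /= ct h3 h4.
  by rewrite h4// subr0 (le_trans (h1 ct)) ?ler_norm.
by rewrite h2// sub0r normrN (le_trans (h3 isT)) ?ler_norm.
Qed.

End bumps.

Section lower_bound.
Context {R : realType} {X Y : hilbertType R} (mu : probability (borel X) R).
Variables (p a b : R) (lam : nat -> R) (phi : nat -> X).
Hypothesis p1 : 1 <= p.
Hypothesis cond : measure_conditions mu p lam phi a b.
Hypothesis sepY : separable_space Y.
Variables (gamma : probability (borel Y) R) (sigma B L : R).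
Variable u : Y.
Hypothesis u1 : `|u| = 1.
Variables (d n m : nat) (s : R).
Hypothesis d0 : (0 < d)%N.
Hypothesis n0 : (0 < n)%N.
Hypothesis mn : (2 * m <= n ^ d)%N.
Hypothesis s0 : 0 <= s.
Hypothesis sB : s * (a / n%:R) <= B.
Hypothesis sL : s <= L * Num.sqrt (lam d.-1).

Local Notation cell := {ffun 'I_d -> 'I_n}.
Local Notation data := (m.-tuple (borel X * borel Y)%type).
Local Notation T := (bumps a lam phi).

Let F (theta : {set cell}) (x : X) : Y := (s * T theta x) *: u.

Let FBL_F theta : FBL B L (F theta).
Proof.
split=> [x|x x'].
  rewrite /F normrZ u1 mulr1 ger0_norm; last by rewrite mulr_ge0// bumps_ge0.
  by apply: le_trans sB; rewrite ler_wpM2l// (bumps_le cond n0).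
rewrite /F -scalerBl normrZ u1 mulr1 -mulrBr normrM (ger0_norm s0).
apply: (@le_trans _ _ (s * ((Num.sqrt (lam d.-1))^-1 * `|x - x'|))).
  by rewrite ler_wpM2l// (bumps_lipschitz cond d0).
rewrite mulrA ler_wpM2r// ler_pdivrMr// sqrtr_gt0.
exact: (cond_lambda_gt0 cond).
Qed.

Let unobserved (x : m.-tuple (borel X)) : {set cell} :=
  [set c | [forall j, tent a lam phi c (tnth x j) <= 0]].

(** Each design point lies under at most one tent. *)
Let card_unobserved x : (n ^ d <= 2 * #|unobserved x|)%N.
Proof.
have cardC : #|{: cell}| = (n ^ d)%N by rewrite card_ffun !card_ord.
suff h : (#|~: unobserved x| <= m)%N.
  have := cardsC (unobserved x); rewrite cardC => E.
  by move: mn h; rewrite -E mul2n -addnn; lia.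
have /choice[w wP] : forall c : cell, exists j : option 'I_m,
    c \notin unobserved x -> exists2 j', j = Some j' & 0 < tent a lam phi c (tnth x j').
  move=> c; case: (boolP (c \in unobserved x)) => [_|]; first by exists None.
  rewrite inE negb_forall => /existsP[j]; rewrite -ltNge => tj.
  by exists (Some j) => _; exists j.
have winj : {in ~: unobserved x &, injective w}.
  move=> c c'; rewrite finset.in_setC => cU; rewrite finset.in_setC => c'U.
  have [j -> tj] := wP c cU; have [j' -> tj'] := wP c' c'U; move=> -[jj'].
  by rewrite -jj' in tj'; exact: (tent_disjoint cond n0 tj tj').
have Sinj : injective (@Some 'I_m) by move=> i j [].
rewrite -(card_in_imset winj) -[leqRHS]card_ord -(card_imset _ Sinj).
apply: subset_leq_card; apply/fintype.subsetP => _ /imsetP[c cU ->].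
by move: cU; rewrite finset.in_setC => /wP[j -> _]; apply/imsetP; exists j.
Qed.

Let flip (U theta : {set cell}) : {set cell} := (theta :\: U) :|: (U :\: theta).

Let flipE U theta c : (c \in flip U theta) = (c \in U) (+) (c \in theta).
Proof. by rewrite !inE; case: (c \in U); case: (c \in theta). Qed.

Let flipK U : involutive (flip U).
Proof. by move=> theta; apply/setP => c; rewrite !flipE addbA addbb. Qed.

Let observe_flip theta x e :
  observe sigma (F (flip (unobserved x) theta)) x e = observe sigma (F theta) x e.
Proof.
apply: eq_mktuple => j; congr (_, _ + _); rewrite /F; congr ((_ * _) *: _).
rewrite /bumps; apply: eq_bigr => c _; rewrite flipE.
case: (boolP (c \in unobserved x)) => //=; rewrite inE => /forallP/(_ j) tj.
have -> : tent a lam phi c (tnth x j) = 0.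
  by apply/eqP; rewrite eq_le tj tent_ge0.
by rewrite !if_same.
Qed.

Let kappa : R := s * (a / n%:R / 2) * ((a * b) ^+ d / 2).

Let kappa0 : 0 <= kappa.
Proof.
have a0 := ltW (cond_a_gt0 cond); have b0 := ltW (cond_b_gt0 cond).
by rewrite /kappa !mulr_ge0 ?divr_ge0 ?exprn_ge0 ?mulr_ge0.
Qed.

Let measurable_F theta : measurable_fun [set: borel X] (F theta : borel X -> borel Y).
Proof. exact: FBL_measurable (FBL_F theta). Qed.

Let flip_dist theta x :
  (kappa%:E <= Lp_dist mu p (F theta) (F (flip (unobserved x) theta)))%E.
Proof.
set U := unobserved x.
have a0 := cond_a_gt0 cond; have b0 := cond_b_gt0 cond.
have nR0 : 0 < n%:R :> R by rewrite ltr0n.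
have p0 : 0 <= p by rewrite (le_trans _ p1).
set rho := a / n%:R; have rho0 : 0 < rho by rewrite divr_gt0.
have v0 : 0 <= (a * b) ^+ d / 2 by rewrite divr_ge0// exprn_ge0// mulr_ge0 ?ltW.
have UE : (a * b) ^+ d / 2 <= #|U|%:R * (b * rho) ^+ d.
  have -> : (a * b) ^+ d = (n ^ d)%:R * (b * rho) ^+ d.
    rewrite natrX -exprMn; congr (_ ^+ d); rewrite /rho; field.
    by rewrite pnatr_eq0 -lt0n.
  have br0 : 0 <= (b * rho) ^+ d by rewrite exprn_ge0// mulr_ge0// ltW.
  rewrite mulrAC ler_wpM2r// ler_pdivrMr//.
  by rewrite -natrM ler_nat mulnC card_unobserved.
have fl c : c \in U -> (c \in flip U theta) = (c \notin theta).
  by move=> cU; rewrite flipE cU.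
have H := flip_integral cond d0 n0 s0 p0 fl.
have v1 : (a * b) ^+ d / 2 <= 1.
  have H1 := flip_integral (s := 1) cond d0 n0 ler01 (lexx 0) fl.
  rewrite powRr0 mul1r in H1.
  have {}H1 : (((a * b) ^+ d / 2)%:E <= 1)%E.
    apply: (@le_trans _ _ (#|U|%:R * (b * rho) ^+ d)%:E); first by rewrite lee_fin.
    apply: (le_trans H1).
    by under eq_integral do rewrite powRr0; rewrite integral_probability_cst.
  by rewrite lee_fin in H1.
have -> : Lp_dist mu p (F theta) (F (flip U theta)) =
    ('N[mu]_p%:E[EFin \o (fun x => s * (T theta x - T (flip U theta) x))%R])%E.
  rewrite /Lp_dist /Lp_norm !Lnorm_integral; congr (_ `^ _)%E; apply: eq_integral => y _.
  by rewrite /F normr_id -scalerBl normrZ u1 mulr1 -mulrBr.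
apply: Lnorm_ge_of_integral => //.
apply: le_trans H; rewrite lee_fin /kappa -/rho powRM//; last first.
  by rewrite mulr_ge0// divr_ge0// ltW.
rewrite ler_wpM2l ?powR_ge0//; apply: le_trans UE.
have [->|vn0] := eqVneq ((a * b) ^+ d / 2) 0; first by rewrite powR0// gt_eqF// (lt_le_trans _ p1).
by apply: ge1r_powR => //; rewrite lt_def vn0 v0.
Qed.

(** On the same data the estimator cannot be close both to a function and to its
    flipped version; flipping permutes the sign patterns, hence the sum over all of
    them is at least half of [kappa] per pattern. *)
Let sum_loss (Fhat : data -> X -> Y) x e : estimator mu p data Fhat ->
  ((#|{set cell}|%:R * (kappa / 2))%:E <=
    \sum_(theta : {set cell})
      Lp_dist mu p (F theta) (Fhat (observe sigma (F theta) x e)))%E.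
Proof.
move=> [LpF _]; set U := unobserved x.
pose D theta := Lp_dist mu p (F theta) (Fhat (observe sigma (F theta) x e)).
have D0 theta : (0 <= D theta)%E by exact: Lnorm_ge0.
have DD theta : (kappa%:E <= D theta + D (flip U theta))%E.
  apply: (le_trans (flip_dist theta x)).
  rewrite [X in (_ <= _ + X)%E]/D -/U observe_flip [X in (_ <= _ + X)%E]Lp_dist_sym.
  by apply: Lp_dist_triangle => //; case: (LpF (observe sigma (F theta) x e)).
have : (\sum_(theta : {set cell}) kappa%:E <= \sum_(theta : {set cell}) D theta + \sum_(theta : {set cell}) D theta)%E.
  rewrite [X in (_ <= _ + X)%E](reindex_inj (inv_inj (flipK U))) -big_split /=.
  by apply: lee_sum => theta _.
rewrite sumEFin sumr_const -[_ *+ _]mulr_natl.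
case: (\sum_(theta : {set cell}) D theta)%E => [r| |]; last 2 first.
- by move=> _; rewrite leey.
- by rewrite leeNy_eq.
by rewrite -EFinD !lee_fin mulrA ler_pdivrMr// mulrDr !mulr1.
Qed.

(** The worst case is at least the average over all sign patterns. The pairing of
    the patterns depends on the design, but the sum over all of them does not, so
    the bound can be integrated over any law of the design. *)
Lemma sup_risk_ge {d'} {D : measurableType d'} (Q : probability D R)
    (x : D -> m.-tuple (borel X)) (e : D -> m.-tuple (borel Y))
    (Fhat : data -> X -> Y) :
  measurable_fun [set: D] x -> measurable_fun [set: D] e ->
  estimator mu p data Fhat ->
  ((kappa / 2)%:E <= ereal_sup [set
    \int[Q]_t Lp_dist mu p G (Fhat (observe sigma G (x t) (e t))) | G in FBL B L])%E.
Proof.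
move=> mx me est; set S := ereal_sup _.
have S_ge theta : (\int[Q]_t Lp_dist mu p (F theta) (Fhat (observe sigma (F theta) (x t) (e t))) <= S)%E.
  by apply: ereal_sup_ubound; exists (F theta); first exact: FBL_F.
have [->|Soo] := eqVneq S +oo%E; first by rewrite leey.
have Sf : S \is a fin_num.
  rewrite ge0_fin_numE ?ltey//; apply: le_trans (S_ge finset.set0).
  by apply: integral_ge0 => t _; exact: Lnorm_ge0.
have N0 : 0 < #|{set cell}|%:R :> R by rewrite ltr0n; apply/card_gt0P; exists finset.set0.
have : ((#|{set cell}|%:R * (kappa / 2))%:E <= #|{set cell}|%:R%:E * S)%E.
  apply: (@le_trans _ _ (\int[Q]_t \sum_(theta : {set cell})
      Lp_dist mu p (F theta) (Fhat (observe sigma (F theta) (x t) (e t))))%E).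
    rewrite -(integral_probability_cst Q); apply: ge0_le_integral => //.
    - by move=> t _; rewrite lee_fin mulr_ge0// divr_ge0.
    - apply: emeasurable_sum => theta.
      have FLp : Lp mu p (F theta).
        exact: (bounded_Lp mu p1 (measurable_F theta) (FBL_F theta).1).
      have mo := measurable_observe sepY sigma (measurable_F theta) mx me.
      exact: (measurableT_comp (measurable_loss p1 sepY est FLp) mo).
    - by move=> t _; exact: sum_loss.
  rewrite ge0_integral_sum//; last 2 first.
  - move=> theta.
    have FLp : Lp mu p (F theta).
      exact: (bounded_Lp mu p1 (measurable_F theta) (FBL_F theta).1).
    have mo := measurable_observe sepY sigma (measurable_F theta) mx me.
    exact: (measurableT_comp (measurable_loss p1 sepY est FLp) mo).
  - by move=> theta t _; exact: Lnorm_ge0.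
  apply: (@le_trans _ _ (\sum_(theta : {set cell}) S)%E); first exact: lee_sum.
  by rewrite -(fineK Sf) sumEFin sumr_const -EFinM mulr_natl.
by rewrite EFinM lee_pmul2l.
Qed.

Lemma minimax_risk_ge (k : design_kind) :
  ((s * (a / n%:R) * (a * b) ^+ d / 8)%:E <= minimax_risk mu p gamma sigma (FBL B L) m k)%E.
Proof.
have -> : s * (a / n%:R) * (a * b) ^+ d / 8 = kappa / 2.
  by rewrite /kappa; field; rewrite pnatr_eq0 -lt0n.
case: k; apply: le_ereal_inf_tmp => _ [w _ <-]; apply: le_ereal_inf_tmp => _ [Fhat est <-].
- by apply: (@sup_risk_ge _ _ (iid gamma m) (fun=> w) id).
- by apply: (@sup_risk_ge _ _ (iid w m \x iid gamma m)%E fst snd).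
Qed.

End lower_bound.

(** * Logarithmic scale *)

Section log_scale.
Context {R : realType}.
Implicit Types (x y sigma K : R).

Lemma near_ln_ge K : \forall m \near \oo, K <= ln m%:R :> R.
Proof.
near=> m; rewrite -(expRK K) ler_ln ?posrE ?expR_gt0//.
  by near: m; exact: nbhs_infty_ger.
by rewrite ltr0n; near: m; exact: nbhs_infty_gt.
Unshelve. all: by end_near. Qed.

(** The noise level is fixed, so on the logarithmic scale it is invisible. *)
Lemma near_ln_noise sigma : 0 < sigma -> \forall m \near \oo,
  ln m%:R / 2 <= ln (m%:R / sigma ^+ 2) :> R /\
  ln (m%:R / sigma ^+ 2) <= 2 * ln m%:R :> R.
Proof.
move=> s0; near=> m.
have m0 : 0 < m%:R :> R by rewrite ltr0n; near: m; exact: nbhs_infty_gt.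
have : 2 * `|ln (sigma ^+ 2)| <= ln m%:R by near: m; exact: near_ln_ge.
have := ler_norm (ln (sigma ^+ 2)); have := ler_norm (- ln (sigma ^+ 2)).
rewrite normrN ln_div ?posrE ?exprn_gt0//.
set l := ln (sigma ^+ 2); set x := ln m%:R; lra.
Unshelve. all: by end_near. Qed.

Lemma ln_le_sqrt x : 0 < x -> ln x <= 2 * Num.sqrt x.
Proof.
move=> x0; have s0 : 0 < Num.sqrt x by rewrite sqrtr_gt0.
rewrite -{1}(sqr_sqrtr (ltW x0)) lnXn// mulr_natl lerMn2r/=.
exact: ltW (ln_sublinear s0).
Qed.

Lemma ratio_ln_le x y : 4 <= x -> x / 2 <= y -> y <= 2 * x ->
  1 <= ln x /\ 0 < y / ln y <= 4 * (x / ln x).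
Proof.
move=> x4 xy yx; have x0 : 0 < x by lra. have y0 : 0 < y by lra.
have l2 : 1 / 2 <= ln 2 :> R.
  have := @le_ln1Dx R (- 2^-1) ltac:(lra).
  have -> : 1 + - 2^-1 = 2^-1 :> R by lra.
  rewrite lnV ?posrE//; lra.
have l4 : ln 4 = 2 * ln 2 :> R by rewrite mulr_natl -lnXn//; congr ln; lra.
have lx : ln 4 <= ln x by rewrite ler_ln ?posrE//; lra.
have ly : ln x - ln 2 <= ln y.
  by rewrite -ln_div ?posrE// ler_ln ?posrE//; lra.
have ly2 : ln x / 2 <= ln y by lra.
have ly0 : 0 < ln y by lra.
have lx0 : 0 < ln x by lra.
split; first by lra.
rewrite divr_gt0//= ler_pdivrMr// mulrA mulrAC ler_pdivlMr//.
have : y * ln x <= (2 * x) * ln x by rewrite ler_wpM2r// ltW.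
have : (x * (ln x / 2)) <= x * ln y by rewrite ler_wpM2l// ltW.
lra.
Qed.

(** With [m] samples one can afford [d] dimensions as soon as
[c * d * ln d <= ln m], and this allows for [d] of order
[ln m / ln (ln m)]. *)
Lemma near_dimension (c : nat) sigma (P : set nat) : (0 < c)%N -> 0 < sigma ->
  (\forall d \near \oo, P d) ->
  \forall m \near \oo, exists d : nat, [/\ (0 < d)%N, P d, ((d ^ d) ^ c <= m)%N &
    0 < ln (m%:R / sigma ^+ 2) / ln (ln (m%:R / sigma ^+ 2)) <= (8 * c%:R * d%:R : R)].
Proof.
move=> c0 s0 [d0 _ hd0]; near=> m.
have m0 : 0 < m%:R :> R by rewrite ltr0n; near: m; exact: nbhs_infty_gt.
have c1 : 1 <= c%:R :> R by rewrite ler1n.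
have [xy yx] : ln m%:R / 2 <= ln (m%:R / sigma ^+ 2) :> R /\
    ln (m%:R / sigma ^+ 2) <= 2 * ln m%:R :> R by near: m; exact: near_ln_noise.
have x4 : 4 <= ln m%:R :> R by near: m; exact: near_ln_ge.
have xK : (2 * c%:R * d0.+1%:R) ^+ 2 <= ln m%:R :> R by near: m; exact: near_ln_ge.
set y := ln (m%:R / sigma ^+ 2) in xy yx *; set x := ln m%:R in xy yx x4 xK.
have [lx /andP[z0 zx]] := ratio_ln_le x4 xy yx.
have x0 : 0 < x by lra.
have lx0 : 0 < ln x by lra.
have cl0 : 0 < c%:R * ln x by rewrite mulr_gt0//; lra.
pose w := x / (c%:R * ln x).
have w0 : 0 <= w by rewrite divr_ge0// ltW.
have wK : d0.+1%:R <= w.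
  rewrite ler_pdivlMr//.
  have sx : 2 * c%:R * d0.+1%:R <= Num.sqrt x.
    have k0 : 0 <= 2 * c%:R * d0.+1%:R :> R by rewrite !mulr_ge0.
    by rewrite -(ger0_norm k0) -sqrtr_sqr ler_sqrt// ltW.
  apply: (@le_trans _ _ (d0.+1%:R * (c%:R * (2 * Num.sqrt x)))).
    by rewrite !ler_wpM2l// ln_le_sqrt.
  apply: (@le_trans _ _ (Num.sqrt x * Num.sqrt x)); last first.
    by rewrite -expr2 sqr_sqrtr// ltW.
  have -> : d0.+1%:R * (c%:R * (2 * Num.sqrt x)) = 2 * c%:R * d0.+1%:R * Num.sqrt x.
    by ring.
  by rewrite ler_wpM2r ?sqrtr_ge0.
have /andP[dw wd] := truncn_itv w0.
set d := Num.truncn w in dw wd.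
have dd0 : (d0 <= d)%N.
  by rewrite -ltnS -(ltr_nat R); apply: le_lt_trans wd; apply: le_trans wK; rewrite ler_nat.
have d1 : (0 < d)%N.
  by rewrite lt0n; apply/eqP => dE; move: wd; rewrite dE => wd;
     have : 1 <= d0.+1%:R :> R by [rewrite ler1n]; lra.
exists d; split => //; first exact: hd0.
- rewrite -(ler_nat R) -ler_ln ?posrE ?ltr0n ?expn_gt0 ?d1//; last by rewrite -(ltr0n R).
  have dp : 0 < d%:R :> R by rewrite ltr0n.
  rewrite !natrX lnXn ?exprn_gt0// lnXn// -[leLHS]mulr_natl -[_ *+ d]mulr_natl -/x.
  have dx : d%:R <= x.
    apply: (le_trans dw); rewrite ler_pdivrMr// -[leLHS]mulr1 ler_wpM2l ?(ltW x0)//.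
    by rewrite -[leLHS]mulr1 ler_pM.
  have ldx : ln d%:R <= ln x by rewrite ler_ln.
  apply: (@le_trans _ _ (c%:R * (w * ln x))).
    rewrite ler_wpM2l//; apply: (@le_trans _ _ (d%:R * ln x)).
      by rewrite ler_wpM2l.
    by rewrite ler_wpM2r// ltW.
  by rewrite mulrCA /w divfK// gt_eqF.
- apply/andP; split => //; apply: (le_trans zx).
  have -> : 4 * (x / ln x) = 4 * c%:R * w.
    by rewrite /w; field; rewrite !gt_eqF//; lra.
  have : 4 * c%:R * w <= 4 * c%:R * (2 * d%:R).
    rewrite ler_wpM2l ?mulr_ge0// ltW// (lt_le_trans wd)//.
    by rewrite -natrM ler_nat mul2n -addnn -addn1 leq_add2l.
  lra.
Unshelve. all: by end_near. Qed.

Lemma log_risk_ge (M : \bar R) (v : R) : 0 < v -> (M <= v%:E)%E ->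
  ((- ln v)%:E <= - lne M)%E.
Proof.
move=> v0 Mv; rewrite EFinN leeN2 -lne_EFin//.
have [M0|M0] := leP M 0%E; first by rewrite (le0_lneNy M0) leNye.
by rewrite lee_lne// ?in_itv/= ?leey ?andbT ?lee_fin ltW.
Qed.

Lemma log_risk_le (M : \bar R) (v : R) : 0 < v -> (v%:E <= M)%E ->
  (- lne M <= (- ln v)%:E)%E.
Proof.
move=> v0 Mv; rewrite EFinN leeN2 -lne_EFin//.
rewrite lee_lne// ?in_itv/= ?leey ?andbT ?lee_fin ?ltW//.
by rewrite (lt_le_trans _ Mv)// lte_fin.
Qed.

(** Taking [d] of order [sqrt (ln m)] balances the two losses in the lower
bound: a mesh of [n] about [expR d] points per axis gives [n ^ d >= 2 * m]
cells, and both the height [1 / n] of the bumps and the mass [w ^+ d] of the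
cells are exponential in [d]; the rest, powers of [d] included, is absorbed. *)
Lemma near_mesh (w A B tau sigma : R) : 0 < w -> 0 < A -> 0 < B -> 0 < sigma ->
  \forall m \near \oo, exists d n : nat,
    [/\ (0 < d)%N, (0 < n)%N, (2 * m <= n ^ d)%N, A / n%:R <= B &
      - ln (A * Num.sqrt (d%:R `^ - tau) / n%:R * w ^+ d / 8) <=
        4 * (5 + `|ln w|) * Num.sqrt (ln (m%:R / sigma ^+ 2))].
Proof.
move=> w0 A0 B0 s0; near=> m.
have m0 : 0 < m%:R :> R by rewrite ltr0n; near: m; exact: nbhs_infty_gt.
have [xy yx] : ln m%:R / 2 <= ln (m%:R / sigma ^+ 2) :> R /\
    ln (m%:R / sigma ^+ 2) <= 2 * ln m%:R :> R by near: m; exact: near_ln_noise.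
have big K : K ^+ 2 <= ln m%:R -> K <= Num.sqrt (ln m%:R).
  move=> Km; apply: (le_trans (ler_norm K)); rewrite -sqrtr_sqr ler_sqrt//.
  exact: le_trans (sqr_ge0 K) Km.
have xA : A / B <= Num.sqrt (ln m%:R) by apply: big; near: m; exact: near_ln_ge.
have x2 : 2 <= Num.sqrt (ln m%:R) :> R by apply: big; near: m; exact: near_ln_ge.
have xl : `|ln (A / 8)| <= Num.sqrt (ln m%:R) by apply: big; near: m; exact: near_ln_ge.
have xt : `|tau| ^+ 2 <= Num.sqrt (ln m%:R) by apply: big; near: m; exact: near_ln_ge.
set y := ln (m%:R / sigma ^+ 2) in xy yx *; set x := ln m%:R in xy yx xA x2 xl xt.
have x0 : 0 <= x by apply: ltW; rewrite -sqrtr_gt0; lra.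
have /andP[dw wd] := truncn_itv (sqrtr_ge0 x).
set t := Num.truncn _ in dw wd.
(* d >= sqrt x + 1, so that d ^+ 2 >= x + 1 exceeds the logarithm of 2 * m *)
pose d := t.+2.
have dE : d%:R = t.+1%:R + 1 :> R by rewrite /d -[in RHS]natr1 -!natr1.
have dS : t.+1%:R = t%:R + 1 :> R by rewrite -natr1.
have sd : Num.sqrt x + 1 <= d%:R by lra.
have ds : d%:R <= 2 * Num.sqrt x by lra.
have dp : 0 < d%:R :> R by rewrite ltr0n.
have d1 : 1 <= d%:R :> R by rewrite ler1n.
have d0 : (0 < d)%N by [].
clearbody d.
have e0 : 0 <= expR d%:R :> R by exact: expR_ge0.
have /andP[nw wn] := truncn_itv e0.
set n := (Num.truncn _).+1 in nw wn *.
have np : 0 < n%:R :> R by rewrite ltr0n.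
have n2 : n%:R <= 2 * expR d%:R :> R.
  have nE : n%:R = (Num.truncn (expR d%:R : R))%:R + 1 :> R by rewrite natr1.
  by have := expR_ge1Dx (d%:R : R); lra.
clearbody n.
exists d, n; split => //; first by rewrite -(ltr0n R).
- rewrite -(ler_nat R) natrX natrM -(@ler_ln R) ?posrE ?mulr_gt0 ?exprn_gt0//.
  rewrite lnXn// lnM ?posrE//.
  have : d%:R <= ln n%:R :> R by rewrite -{1}(expRK d%:R) ler_ln ?posrE ?expR_gt0// ltW.
  move=> dn; rewrite -[leRHS]mulr_natl -/x.
  have l2 : ln 2 < 2 :> R by exact: ln_sublinear.
  have : d%:R * d%:R <= d%:R * ln n%:R :> R by rewrite ler_wpM2l.
  have : (Num.sqrt x + 1) * (Num.sqrt x + 1) <= d%:R * d%:R.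
    by rewrite ler_pM// addr_ge0// sqrtr_ge0.
  have := sqr_sqrtr x0; lra.
- rewrite ler_pdivrMr//; rewrite ler_pdivrMr// in xA.
  rewrite (le_trans xA)// mulrC ler_wpM2l ?(ltW B0)//.
  have := expR_ge1Dx (d%:R : R); lra.
- have ln_n : ln n%:R <= ln 2 + d%:R :> R.
    by rewrite -[X in _ + X]expRK -lnM ?posrE ?expR_gt0// ler_ln ?posrE ?mulr_gt0 ?expR_gt0.
  have l2 : ln 2 < 2 :> R by exact: ln_sublinear.
  have p0 : 0 < d%:R `^ - tau :> R by rewrite powR_gt0.
  have q0 : 0 < Num.sqrt (d%:R `^ - tau) :> R by rewrite sqrtr_gt0.
  have -> : A * Num.sqrt (d%:R `^ - tau) / n%:R * w ^+ d / 8 =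
      (A / 8) * Num.sqrt (d%:R `^ - tau) / n%:R * w ^+ d by ring.
  rewrite lnM ?posrE ?exprn_gt0 ?divr_gt0 ?mulr_gt0//.
  rewrite ln_div ?posrE ?mulr_gt0 ?divr_gt0// lnM ?posrE ?divr_gt0//.
  have lq : 2 * ln (Num.sqrt (d%:R `^ - tau)) = - tau * ln d%:R :> R.
    by rewrite mulr_natl -lnXn// sqr_sqrtr ?(ltW p0)// ln_powR.
  rewrite lnXn//.
  have ld : `|tau * ln d%:R| <= 2 * d%:R.
    rewrite normrM (ger0_norm (ln_ge0 d1)).
    have := ln_le_sqrt dp.
    have sp : 0 <= Num.sqrt d%:R :> R by rewrite sqrtr_ge0.
    have td : `|tau| <= Num.sqrt d%:R :> R.
      rewrite -(ger0_norm (normr_ge0 tau)) -sqrtr_sqr ler_sqrt//; lra.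
    have := sqr_sqrtr (ltW dp).
    move=> dd h; apply: (@le_trans _ _ (Num.sqrt d%:R * (2 * Num.sqrt d%:R))).
      by rewrite ler_pM// ln_ge0.
    lra.
  have sy : Num.sqrt x <= 2 * Num.sqrt y.
    have -> : 2 = Num.sqrt (2 ^+ 2) :> R by rewrite sqrtr_sqr ger0_norm.
    by rewrite -sqrtrM ?sqr_ge0// ler_sqrt//; lra.
  rewrite -[ln w *+ d]mulr_natl.
  have := ler_norm (- ln (A / 8)); rewrite normrN.
  have := ler_norm (tau * ln d%:R).
  have wl : - (d%:R * ln w) <= d%:R * `|ln w|.
    by rewrite -mulrN ler_wpM2l// -normrN ler_norm.
  have bnd : d%:R * (5 + `|ln w|) <= 4 * (5 + `|ln w|) * Num.sqrt y.
    apply: (@le_trans _ _ (4 * Num.sqrt y * (5 + `|ln w|))); last by rewrite mulrAC.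
    by rewrite ler_wpM2r ?addr_ge0//; lra.
  lra.
Unshelve. all: by end_near. Qed.

End log_scale.

(** * The two bounds on the log-risk *)

(* The upper bound is false for B = 0 (the risk is 0) and for L = 0 (constants
   can be estimated at the rate m^(-1/2)), hence its positivity hypotheses. *)
Theorem theorem2p9 (R : realType) :
  (forall (tau iota B L p : R) (Y : hilbertType R) (Upsilon : {linear Y -> Y}),
    exists C : R,
    forall (X : hilbertType R) (mu : probability (borel X) R)
      (gamma : probability (borel Y) R) (sigma : R) (k : design_kind),
      model mu gamma Upsilon tau iota p B L sigma ->
    exists r : nat -> R, \forall m \near \oo,
      `|r m| <= C /\
      (((tau - 1) / 2 * ln (ln (m%:R / sigma ^+ 2)
                            / ln (ln (m%:R / sigma ^+ 2))) + r m)%:E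
        <= log_minimax_risk mu p gamma sigma (FBL B L) m k)%E)
  /\
  (forall iota p : R,
    exists2 c : R, 0 < c &
    forall (X Y : hilbertType R) (mu : probability (borel X) R)
      (gamma : probability (borel Y) R) (Upsilon : {linear Y -> Y})
      (tau B L sigma : R) (k : design_kind),
      model mu gamma Upsilon tau iota p B L sigma -> 0 < B -> 0 < L ->
    \forall m \near \oo,
      (log_minimax_risk mu p gamma sigma (FBL B L) m k
        <= (c * Num.sqrt (ln (m%:R / sigma ^+ 2)))%:E)%E).
Proof.
split.
- move=> tau iota B L p Y Upsilon.
  have [/and4P[tau1 p1 B0 L0]|bad] := boolP [&& 1 < tau, 1 <= p, 0 <= B & 0 <= L].
  + have [kap [K K0 rate]] := risk_upper_rate tau1 p1 B0 L0.
    pose c := ((2 * kap + 2) * 4)%N.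
    have c0 : (0 < c)%N by rewrite muln_gt0 addn_gt0 orbT.
    have c0R : 0 < 8 * c%:R :> R by rewrite mulr_gt0// ltr0n.
    pose q := (tau - 1) / 2.
    have q0 : 0 < q by rewrite divr_gt0// subr_gt0.
    pose V := K * (8 * c%:R) `^ q.
    have V0 : 0 < V by rewrite mulr_gt0// powR_gt0.
    exists `|ln V| => X mu gamma sigma k md.
    exists (fun=> - ln V).
    have s0 : 0 < sigma := model_sigma md.
    have := near_dimension c0 s0 (rate X Y mu gamma Upsilon iota sigma k md).
    apply: filterS => m [d [d0 hd dm /andP[z0 zd]]]; split; first by rewrite normrN.
    move: z0 zd; set z := ln _ / _ => z0 zd.
    have -> : (tau - 1) / 2 * ln z + - ln V = - ln (V * z `^ (- q)).
      by rewrite lnM ?posrE ?powR_gt0// ln_powR -/q; lra.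
    apply: log_risk_ge; first by rewrite mulr_gt0// powR_gt0.
    have dE : (((d ^ (2 * kap + 2)) ^ d) ^ 4 = (d ^ d) ^ c)%N.
      by rewrite -!expnM /c; congr (d ^ _)%N; ring.
    apply: (le_trans (hd m _)); first by rewrite dE.
    rewrite lee_fin /V -mulrA ler_pM2l// powRN powRN -/q.
    have dp : 0 < d%:R :> R by rewrite ltr0n.
    rewrite -ler_pdivrMl ?powR_gt0// -invfM lef_pV2 ?posrE ?mulr_gt0 ?powR_gt0//.
    rewrite -powRM ?(ltW c0R) ?(ltW dp)//.
    by apply: powR_le_base => //; rewrite ltW.
  (* outside this range of parameters there is no model *)
  + exists 0 => X mu gamma sigma k md; exfalso; move/negP: bad; apply.
    by apply/and4P; split; [exact: model_tau md|exact: model_p md|exact: model_B md|exact: model_L md].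
- move=> iota p; pose w := iota / 2.
  exists (4 * (5 + `|ln w|)); first by rewrite mulr_gt0// ltr_wpDr.
  move=> X Y mu gamma Upsilon tau B L sigma k md B0 L0.
  have [phi [a [b [iotaE cond]]]] := model_mu md.
  have [u u1] := noise_unit_vector (model_noise md).
  have a0 := cond_a_gt0 cond; have b0 := cond_b_gt0 cond.
  have wE : w = a * b by rewrite /w iotaE; lra.
  have w0 : 0 < w by rewrite wE mulr_gt0.
  have := near_mesh tau w0 (mulr_gt0 L0 a0) B0 (model_sigma md).
  apply: filterS => m [d [n [d0 n0 mn hB hln]]].
  have dp : 0 < d%:R :> R by rewrite ltr0n.
  have np : 0 < n%:R :> R by rewrite ltr0n.
  pose s := L * Num.sqrt (d%:R `^ - tau).
  have q0 : 0 < Num.sqrt (d%:R `^ - tau) :> R by rewrite sqrtr_gt0 powR_gt0.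
  have s0 : 0 < s by rewrite mulr_gt0.
  have sL : s <= L.
    rewrite /s -[leRHS]mulr1 ler_wpM2l ?(ltW L0)// -[leRHS]sqrtr1 ler_sqrt// powRN.
    have tau0 : 0 <= tau by rewrite (le_trans ler01)// ltW// (model_tau md).
    have := powR_le_base tau0 ler01 (_ : 1 <= d%:R :> R).
    by rewrite powR1 ler1n invf_le1 ?powR_gt0//; apply.
  have sB : s * (a / n%:R) <= B.
    apply: le_trans hB; rewrite mulrA ler_wpM2r ?invr_ge0 ?(ltW np)//.
    by rewrite ler_wpM2r ?(ltW a0).
  have sl : s <= L * Num.sqrt (d.-1.+1%:R `^ - tau) by rewrite prednK.
  have := minimax_risk_ge (model_p md) cond (model_sepY md) gamma sigma u1 d0 n0 mn
    (ltW s0) sB sl k.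
  have sE : s * (a / n%:R) * (a * b) ^+ d / 8 =
      L * a * Num.sqrt (d%:R `^ - tau) / n%:R * w ^+ d / 8.
    by rewrite wE /s; field; rewrite gt_eqF.
  rewrite sE => h; apply: (le_trans (log_risk_le _ h)); last by rewrite lee_fin.
  by rewrite divr_gt0// mulr_gt0 ?exprn_gt0// divr_gt0// !mulr_gt0.
Qed.
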